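(* If $G_0\in\mathcal{F}_3$, then $\mathsf{in}_t(G_0)\ge 4$.
   Context: A bipath is the union of two edge-disjoint paths $P_1,P_2$ that have the same two endpoints, share at least three vertices in total (including the endpoints), and the shared vertices appear in the same order along $P_1$ and $P_2$; its endpoints are the common endpoints of $P_1,P_2$. $\mathcal{F}_3$ is the set of graphs consisting of four bipaths $B_a,B_b,B_c,B_d$ and two paths $P_1,P_2$ such that $B_a,B_b$ share endpoints $v_1,v_2$, $B_c,B_d$ share endpoints $v_3,v_4$, the bipaths are otherwise pairwise vertex-disjoint, $P_1$ has endpoints $v_1,v_3$, $P_2$ has endpoints $v_2,v_4$, and $P_1,P_2$ have no other vertices in common with the bipaths (though $P_1$ and $P_2$ may intersect each other). Zero-visibility $k$-search game on a finite simple graph $G$: an invisible intruder occupies a vertex; players alternate starting with the searcher; on each turn the searcher inspects an arbitrary set of $k$ vertices and wins if the intruder is at one of them; otherwise the intruder may move to an adjacent vertex or stay. $\mathsf{in}(G)$ is the least $k$ for which the searcher has a finite sequence of moves guaranteeing capture. A subdivision is obtained by repeatedly replacing an edge by a path of length two through a new vertex. $\mathsf{in}_t(G)$ is the least $k$ such that every subdivision $H$ of $G$ has a further subdivision $H'$ with $\mathsf{in}(H')\le k$. *)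

(* Defs.v *)
From mathcomp Require Import all_boot.
From mathcomp Require Import boolp.
From mathcomp Require Import zify.

Set Implicit Arguments.
Unset Strict Implicit.
Unset Printing Implicit Defensive.

(** * Finite simple graphs *)

Record sgraph := SGraph {
  vertex :> finType;
  adj : rel vertex;
  adj_sym : symmetric adj;
  adj_irr : irreflexive adj
}.

(** * The zero-visibility search game *)

(* The trajectory is infinite for convenience: only its first [size s]
   positions matter. *)
Definition trajectory (G : sgraph) (w : nat -> G) : Prop :=
  forall i, w i.+1 = w i \/ adj (w i) (w i.+1).

(* As the searcher gets no information before capture, a strategy is a fixed
   finite sequence of inspected sets; the i-th inspection (counting from 0)
   happens before the intruder's move from [w i] to [w i.+1]. *)
Definition captures (G : sgraph) (s : seq {set G}) : Prop :=
  forall w : nat -> G, trajectory w ->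
    exists2 i, i < size s & w i \in nth set0 s i.

Definition searchable (G : sgraph) (k : nat) : Prop :=
  exists s : seq {set G}, (forall S, S \in s -> #|S| = k) /\ captures s.

Lemma searchable_card (G : sgraph) : searchable G #|G|.
Proof.
exists [:: [set: G]]; split=> [S|w _]; last by exists 0; rewrite // inE.
by rewrite inE => /eqP->; rewrite cardsT.
Qed.

Lemma ex_searchable (G : sgraph) : exists k, `[< searchable G k >].
Proof. by exists #|G|; apply/asboolP/searchable_card. Qed.

Definition inspection_number (G : sgraph) : nat := ex_minn (ex_searchable G).

Lemma inspection_number_min (G : sgraph) k :
  searchable G k -> inspection_number G <= k.
Proof.
by rewrite /inspection_number; case: ex_minnP => m _ mP /asboolP/mP.
Qed.

(** * Subdivisions *)

Section Subdivide.
Variables (G : sgraph) (x y : G).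

(* [None] is the new vertex. *)
Definition subdivide_adj : rel (option G) := fun a b =>
  match a, b with
  | Some u, Some v => adj u v && ([set u; v] != [set x; y])
  | Some u, None | None, Some u => u \in [set x; y]
  | None, None => false
  end.

Lemma subdivide_adj_sym : symmetric subdivide_adj.
Proof. by case=> [u|] [v|] //=; rewrite adj_sym setUC. Qed.

Lemma subdivide_adj_irr : irreflexive subdivide_adj.
Proof. by case=> [u|] //=; rewrite adj_irr. Qed.

Definition subdivide : sgraph := SGraph subdivide_adj_sym subdivide_adj_irr.

End Subdivide.

(* Taken literally rather than up to isomorphism; this is immaterial, as the
   inspection number is invariant under isomorphism. *)
Inductive subdivision (G : sgraph) : sgraph -> Prop :=
| subdivision_refl : subdivision G G
| subdivision_step (H : sgraph) (x y : H) :
    subdivision G H -> adj x y -> subdivision G (subdivide x y).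

(** * The topological inspection number *)

Definition top_searchable (G : sgraph) (k : nat) : Prop :=
  forall H, subdivision G H ->
    exists2 H', subdivision H H' & inspection_number H' <= k.

(* Well-definedness: in every subdivision [H] of [G], deleting the original
   vertices leaves disjoint paths, which can be laid out on a line.  Inspecting
   all of the original vertices while sweeping the line with two more
   inspections per turn captures the intruder, so [#|G| + 2] suffices. *)

Definition linear_layout n (H : sgraph) (B : {set H}) (pos : H -> nat) : Prop :=
  [/\ #|B| <= n,
      {in ~: B &, injective pos},
      {in ~: B &, forall u v, adj u v ->
         pos u = (pos v).+1 \/ pos v = (pos u).+1} &
      {in ~: B, forall u a b c, adj u a -> adj u b -> adj u c ->
         [\/ a = b, a = c | b = c]}].

Lemma exists_superset (T : finType) (A : {set T}) k :
  #|A| <= k <= #|T| -> exists2 S : {set T}, A \subset S & #|S| = k.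
Proof.
case/andP=> Ak; elim: k Ak => [|k IHk] Ak kT.
  by exists A => //; lia.
case: (ltnP k #|A|) => [kA|Ak']; first by exists A => //; lia.
have [S AS Sk] := IHk Ak' (ltnW kT).
have [x xS] : exists x, x \in ~: S.
  by apply/set0Pn; rewrite -card_gt0 cardsCs setCK Sk subn_gt0.
rewrite inE in xS; exists (x |: S); first exact: subset_trans AS (subsetUr _ _).
by rewrite cardsU1 xS Sk.
Qed.

Lemma captures_le (G : sgraph) k (s : seq {set G}) :
  (forall S, S \in s -> #|S| <= k) -> captures s -> inspection_number G <= k.
Proof.
move=> sk sC; case: (leqP k #|G|) => [kG|Gk]; last first.
  exact: leq_trans (inspection_number_min (searchable_card G)) (ltnW Gk).
have ext (S : {set G}) :
    exists T : {set G}, #|S| <= k -> S \subset T /\ #|T| = k.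
  case: (leqP #|S| k) => [Sk|_]; last by exists set0.
  have [|T ST Tk] := @exists_superset _ S k; first by rewrite Sk.
  by exists T.
have [f fP] := choice ext; apply: inspection_number_min.
exists (map f s); split=> [S /mapP[T Ts ->]|w wT].
  exact: (fP T (sk T Ts)).2.
have [i si wi] := sC w wT; exists i; first by rewrite size_map.
rewrite (nth_map set0) //; apply: subsetP wi.
exact: (fP _ (sk _ (mem_nth set0 si))).1.
Qed.

Lemma linear_layout_bound n (H : sgraph) B pos :
  @linear_layout n H B pos -> inspection_number H <= n + 2.
Proof.
case=> Bn pos_inj pos_adj _.
pose L i := [set v in ~: B | pos v == i].
have L1 i : #|L i| <= 1.
  rewrite leqNgt; apply/negP => /card_gt1P[u [v [uL vL /eqP]]]; apply.
  move: uL vL; rewrite !in_set => /andP[uB /eqP up] /andP[vB /eqP vp].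
  by apply: pos_inj; rewrite ?in_setC ?up ?vp.
pose S i := B :|: (L i :|: L i.+1).
pose M := \max_(v : H) pos v.
apply: (@captures_le _ _ (mkseq S M.+1)) => [T /mapP[i _ ->]|w wT].
  have := L1 i; have := L1 i.+1; rewrite /S.
  have := (leq_card_setU B (L i :|: L i.+1)).1.
  have := (leq_card_setU (L i) (L i.+1)).1; move: Bn; clear; lia.
apply: contrapT => nC.
have free i : i <= M -> w i \notin S i.
  move=> iM; apply/negP => wi; apply: nC.
  by exists i; rewrite ?size_mkseq // nth_mkseq.
have above i : i <= M -> w i \notin B /\ i.+2 <= pos (w i).
  elim: i => [|i IHi] iM; have := free _ iM; rewrite !inE !negb_or.
    by case/and3P=> -> /=; split=> //; lia.
  case/and3P=> wB; rewrite wB /= => p1 p2; split=> //.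
  have [wB' p'] := IHi (ltnW iM).
  case: (wT i) => [e|a]; first by move: p1 p2; rewrite e; lia.
  by have := pos_adj (w i) (w i.+1); rewrite !inE => /(_ wB' wB a); lia.
have [_] := above M (leqnn M).
have : pos (w M) <= M by rewrite /M; apply: leq_bigmax.
lia.
Qed.

Lemma subdivide_layout n (H : sgraph) (x y : H) B pos :
    @linear_layout n H B pos -> adj x y ->
  exists (B' : {set subdivide x y}) pos', @linear_layout n _ B' pos'.
Proof.
case=> Bn pos_inj pos_adj deg2 xy.
have neq_xy : x != y by apply: contraTneq xy => ->; rewrite adj_irr.
pose nb u := (u \notin B).
have inj u v : nb u -> nb v -> pos u = pos v -> u = v.
  by move=> uB vB; apply: pos_inj; rewrite inE.
have adjP u v : nb u -> nb v -> adj u v ->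
    pos u = (pos v).+1 \/ pos v = (pos u).+1.
  by move=> uB vB; apply: pos_adj; rewrite inE.
have [m [m_split m_new]] : exists m,
    (forall u v, nb u -> nb v -> adj u v -> [set u; v] != [set x; y] ->
       ~ ((pos u).+1 = m /\ pos v = m)) /\
    (forall u, nb u -> u \in [set x; y] -> (pos u).+1 = m \/ pos u = m).
  have mixed a b : [set a; b] = [set x; y] -> adj a b -> ~~ nb a -> nb b ->
      exists m,
        (forall u v, nb u -> nb v -> adj u v -> [set u; v] != [set x; y] ->
       ~ ((pos u).+1 = m /\ pos v = m)) /\
      (forall u, nb u -> u \in [set x; y] -> (pos u).+1 = m \/ pos u = m).
    move=> ab_xy ab aB bB.
    have [[z [zB bz zp]]|noz] :=
      pselect (exists z, [/\ nb z, adj b z & pos z = (pos b).+1]).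
      exists (pos b); split=> [u v uB vB uv _ [up vp]|u uB].
        have vb : v = b by apply: inj.
        subst v; have := deg2 b; rewrite inE => /(_ bB a z u).
        rewrite adj_sym ab bz adj_sym uv => /(_ isT isT isT)[] e; subst.
        - by rewrite zB in aB.
        - by rewrite uB in aB.
        - by lia.
      rewrite -ab_xy !inE => /orP[]/eqP e; subst; first by rewrite uB in aB.
      by right.
    exists (pos b).+1; split=> [u v uB vB uv _ [[up] vp]|u uB].
      have ub : u = b by apply: inj.
      by subst u; apply: noz; exists v.
    rewrite -ab_xy !inE => /orP[]/eqP e; subst; first by rewrite uB in aB.
    by left.
  case: (boolP (nb x)) => xB; case: (boolP (nb y)) => yB.
  - have pxy := adjP y x yB xB (etrans (adj_sym y x) xy).
    exists (maxn (pos x) (pos y)); split=> [u v uB vB uv /eqP ne [up vp]|u _].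
      case: pxy => p.
        have ux : u = x by apply: inj => //; lia.
        have vy : v = y by apply: inj => //; lia.
        by subst.
      have ux : u = y by apply: inj => //; lia.
      have vy : v = x by apply: inj => //; lia.
      by subst; rewrite setUC in ne.
    by rewrite !inE => /orP[]/eqP->; lia.
  - by apply: (mixed y x) => //; [rewrite setUC | rewrite adj_sym].
  - exact: (mixed x y).
  - exists 0; split=> [u v _ _ _ _ []//|u uB].
    by rewrite !inE => /orP[]/eqP e; subst; rewrite uB in xB yB.
exists (Some @: B), (fun o => if o is Some u then pos u + (m <= pos u) else m).
have SomeB u : (Some u \in ~: (Some @: B)) = nb u.
  by rewrite inE mem_imset // => ? ? [].
split.
- by rewrite card_imset // => ? ? [].
- move=> [u|] [v|] //; rewrite ?SomeB => uB vB; try lia.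
  by move=> p; congr Some; apply: inj => //; lia.
- move=> [u|] [v|] //; rewrite ?SomeB => uB vB /=.
  + case/andP=> uv ne; have := adjP u v uB vB uv.
    have := m_split u v uB vB uv ne; have := m_split v u vB uB.
    by rewrite adj_sym uv setUC => /(_ isT ne); lia.
  + by move=> /(m_new _ uB); lia.
  + by move=> /(m_new _ vB); lia.
- move=> [u|]; last first.
    move=> _ [a|] [b|] [c|] //=; rewrite !inE.
    move=> /orP[]/eqP-> /orP[]/eqP-> /orP[]/eqP->;
      by [constructor 1 | constructor 2 | constructor 3].
  rewrite SomeB => uB a b c.
  pose o := if u == x then y else x.
  pose g (a : option H) := if a is Some a then a else o.
  have gP d : adj (Some u : subdivide x y) d -> 
      adj u (g d) /\ (d = if g d == o
        then (if (u == x) || (u == y) then None else Some o) else Some (g d)).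
    rewrite /g /o; case: d => [d|] /=; last first.
      rewrite !inE => /orP[]/eqP e; subst;
        by rewrite ?eqxx ?orbT // 1?eq_sym ?(negPf neq_xy) // adj_sym.
    case/andP=> ud ne; split=> //; case: eqP => [e|//].
    move: ne; rewrite e; case: (eqVneq u x) => [->|ux] /=.
      by rewrite eqxx.
    by case: (eqVneq u y) => [->|//]; rewrite setUC eqxx.
  move=> /gP[ga ea] /gP[gb eb] /gP[gc ec].
  have := deg2 u; rewrite inE => /(_ uB _ _ _ ga gb gc)[] e.
  + by constructor 1; rewrite ea eb e.
  + by constructor 2; rewrite ea ec e.
  + by constructor 3; rewrite eb ec e.
Qed.

Lemma subdivision_layout (G H : sgraph) : subdivision G H ->
  exists (B : {set H}) pos, @linear_layout #|G| H B pos.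
Proof.
elim=> [|K x y _ [B [pos lay]] xy]; last exact: subdivide_layout lay xy.
by exists setT, (fun=> 0); split=> [|u|u|u]; rewrite ?cardsT // inE inE.
Qed.

Lemma top_searchable_card (G : sgraph) : top_searchable G (#|G| + 2).
Proof.
move=> H /subdivision_layout[B [pos lay]].
by exists H; [exact: subdivision_refl | exact: linear_layout_bound lay].
Qed.

Lemma ex_top_searchable (G : sgraph) : exists k, `[< top_searchable G k >].
Proof. by exists (#|G| + 2); apply/asboolP/top_searchable_card. Qed.

Definition top_inspection_number (G : sgraph) : nat :=
  ex_minn (ex_top_searchable G).

(** * Paths, bipaths and the family F_3 *)

Section Paths.
Variable G : sgraph.

(* A path is given by the sequence of all its vertices, endpoints included. *)
Definition is_path (x y : G) (p : seq G) : Prop :=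
  exists q, [/\ p = x :: q, path (@adj G) x q, uniq p & last x q = y].

Definition verts (p : seq G) : {set G} := [set z in p].

Definition edges (p : seq G) : {set {set G}} :=
  [set:: [seq [set e.1; e.2] | e <- zip p (behead p)]].

(* A bipath is given by its two constituent paths. *)
Definition bverts (B : seq G * seq G) : {set G} := verts B.1 :|: verts B.2.

Definition bedges (B : seq G * seq G) : {set {set G}} :=
  edges B.1 :|: edges B.2.

(* The two filtered sequences list the shared vertices in the order in which
   they appear along each of the two paths. *)
Definition is_bipath (x y : G) (B : seq G * seq G) : Prop :=
  [/\ is_path x y B.1, is_path x y B.2,
      [disjoint edges B.1 & edges B.2],
      3 <= #|verts B.1 :&: verts B.2| &
      [seq z <- B.1 | z \in B.2] = [seq z <- B.2 | z \in B.1]].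

End Paths.

(* No condition relates [P1] and [P2], which may share vertices and edges. *)
Definition F3 (G : sgraph) : Prop :=
  exists (v1 v2 v3 v4 : G) (Ba Bb Bc Bd : seq G * seq G) (P1 P2 : seq G),
    let bip := bverts Ba :|: bverts Bb :|: bverts Bc :|: bverts Bd in
    [/\ [/\ is_bipath v1 v2 Ba, is_bipath v1 v2 Bb,
            is_bipath v3 v4 Bc & is_bipath v3 v4 Bd],
        [/\ bverts Ba :&: bverts Bb = [set v1; v2],
            bverts Bc :&: bverts Bd = [set v3; v4] &
            [disjoint bverts Ba :|: bverts Bb & bverts Bc :|: bverts Bd]],
        [/\ is_path v1 v3 P1, is_path v2 v4 P2,
            verts P1 :&: bip = [set v1; v3] & verts P2 :&: bip = [set v2; v4]],
        bip :|: verts P1 :|: verts P2 = [set: G] &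
        forall x y : G, adj x y ->
          [set x; y] \in bedges Ba :|: bedges Bb :|: bedges Bc :|: bedges Bd
                           :|: edges P1 :|: edges P2].

(* Main.v *)
Require Import Defs.
From mathcomp Require Import all_boot.
From mathcomp Require Import boolp.
From mathcomp Require Import zify.

(* Call a set [X] of cleared vertices and count it inside a fixed set [Z]: each
   turn loses the boundary [bd Z X] and gains at most three vertices, so three
   inspections per turn fail as soon as every [X] whose size lies in some window
   of width three has at least three boundary vertices.

   Two shapes have such a window.  A "sun", that is a cycle with three pendant
   legs, each slightly longer than the arc of the cycle opposite to it; and a
   necklace (the union of two bipaths with common endpoints) in which no side of
   a bead is long compared with the rest of the necklace.  If in both necklaces
   of the graph some bead [b] has a side longer than the ring formed by the short
   sides, take the necklace in which the short side of that bead is the shorter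
   one.  Its ring of short sides becomes a sun: two legs are the two ends of the
   long side, and the third one leaves from an endpoint of the bipaths that is
   not on [b], follows a linking path and goes round the other necklace.  All of
   this survives subdivision, provided all segments are long to begin with. *)

Set Implicit Arguments.
Unset Strict Implicit.
Unset Printing Implicit Defensive.

(** * Isoperimetric lower bound, and suns *)

Lemma inspection_number_searchable (G : sgraph) :
  searchable G (inspection_number G).
Proof. by rewrite /inspection_number; case: ex_minnP => m /asboolP. Qed.

Section Cleared.
Variables (G : sgraph) (S : nat -> {set G}).

(** The vertices that cannot hold an uncaught intruder after inspection [n]: those just inspected,
    and those whose closed neighbourhood was entirely cleared one turn earlier. *)
Fixpoint cleared n : {set G} :=
  if n is m.+1 then
    S n :|: [set v in cleared m | [forall u, adj v u ==> (u \in cleared m)]]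
  else S 0.

(** The walk is built backwards: a vertex not cleared at turn [n + 1] has an uncleared vertex in its
    closed neighbourhood at turn [n]. Keeping the walk constant from time [n] on lets the induction
    redirect it afterwards. *)
Lemma uncleared_trajectory n v : v \notin cleared n ->
  exists w : nat -> G,
    [/\ trajectory w, forall i, n <= i -> w i = v &
        forall i, i <= n -> w i \notin S i].
Proof.
elim: n v => [|n IHn] v /=.
  move=> vS; exists (fun=> v); split=> // [i|i]; first by left.
  by rewrite leqn0 => /eqP->.
rewrite !inE negb_or => /andP[vS vC].
have [u [uC uv]] : exists u, u \notin cleared n /\ (v = u \/ adj u v).
  move: vC; rewrite negb_and => /orP[vC|/forallPn[u]].
    by exists v; split=> //; left.
  by rewrite negb_imply => /andP[vu uC]; exists u; split=> //; right; rewrite adj_sym.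
have [w [wT wn wS]] := IHn u uC.
exists (fun i => if i <= n then w i else v); split=> [i|i ni|i].
- case: (ltngtP i n) => [lin|lni|->].
  + by apply: wT.
  + by left.
  + by rewrite wn.
- by rewrite ifF //; lia.
- rewrite leq_eqVlt => /orP[/eqP->|]; first by rewrite ltnn.
  by rewrite ltnS => lin; rewrite lin wS.
Qed.

End Cleared.

(** The inner vertex boundary of [X] in the subgraph induced on [Z]. Neighbours outside [Z] are
    ignored, so a lower bound found inside [Z] holds for the whole graph. *)
Definition bd (G : sgraph) (Z X : {set G}) : {set G} :=
  [set x in X :&: Z | [exists y in Z, adj x y && (y \notin X)]].

Lemma window_bound (G : sgraph) (Z : {set G}) b :
    (forall X : {set G}, b <= #|X :&: Z| <= b + 2 -> 3 <= #|bd Z X|) ->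
    1 <= b -> b + 3 <= #|Z| ->
  4 <= inspection_number G.
Proof.
move=> iso b1 bZ; rewrite leqNgt; apply/negP; rewrite ltnS => in3.
have [s [sk sC]] := inspection_number_searchable G.
pose S i := nth set0 s i.
have S3 i : #|S i| <= 3.
  case: (ltnP i (size s)) => [lis|les]; last by rewrite /S nth_default ?cards0.
  by rewrite (sk _ (mem_nth _ lis)).
(* Below the window a gain of three cannot jump over it; inside the window the loss of three
   boundary vertices cancels the gain. *)
have inv n : #|cleared S n :&: Z| <= b + 2.
  elim: n => [|n IHn] /=.
    by apply: leq_trans (subset_leq_card (subsetIl _ _)) _; apply: leq_trans (S3 0) _; lia.
  set X := cleared S n in IHn *; set K := [set v in X | _].
  have KX : K :&: Z \subset (X :&: Z) :\: bd Z X.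
    apply/subsetP=> v; rewrite !inE => /andP[/andP[vX /forallP vK] vZ].
    rewrite vX vZ /= andbT; apply/existsP=> -[y /and3P[yZ vy yX]].
    by have := vK y; rewrite vy (negPf yX).
  have bX : bd Z X \subset X :&: Z by apply/subsetP=> v; rewrite inE => /andP[].
  have := subset_leq_card KX; have := subset_leq_card bX; rewrite cardsD.
  rewrite (setIidPr bX) setIUl.
  have := (leq_card_setU (S n.+1 :&: Z) (K :&: Z)).1.
  have := subset_leq_card (subsetIl (S n.+1) Z); have := S3 n.+1.
  have := iso X; lia.
have [v vC] : exists v, v \notin cleared S (size s).
  have : ~~ (Z \subset cleared S (size s)).
    apply/negP=> /setIidPr ZC; have := inv (size s); rewrite ZC; lia.
  by case/subsetPn=> v _ vC; exists v.
have [w [wT _ wS]] := uncleared_trajectory vC.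
have [i lis wi] := sC w wT.
by have := wS i (ltnW lis); rewrite wi.
Qed.

(** * Boundary vertices along arcs and legs *)

Section Boundary.
Variables (G : sgraph) (Z X : {set G}).
Local Notation D := (bd Z X).
Implicit Types (x y u v : G) (s w : seq G).

Lemma rev_adj_path x s y :
  path (@adj G) x (rcons s y) -> path (@adj G) y (rcons (rev s) x).
Proof.
move=> p; have := rev_path (@adj G) x (rcons s y).
rewrite last_rcons belast_rcons rev_cons => ->.
by rewrite (eq_path (e' := @adj G)) // => a b; rewrite adj_sym.
Qed.

Lemma bd_step x y :
  adj x y -> x \in Z -> y \in Z -> x \in X -> y \notin X -> x \in D.
Proof.
move=> xy xZ yZ xX yX; rewrite !inE xX xZ /=.
by apply/existsP; exists y; rewrite yZ xy.
Qed.

(** The last vertex before the first exit from [X] is a boundary vertex. As [bd] lies on the side of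
    [X], it comes strictly before [y]; in the reversed version it comes strictly after [x]. *)
Lemma bd_run x s y : path (@adj G) x (rcons s y) ->
    {subset x :: rcons s y <= Z} -> x \in X -> y \notin X ->
  has (mem D) (x :: s).
Proof.
elim: s x => [|a s IHs] x /=.
  by rewrite andbT => xy sZ xX yX; rewrite orbF (bd_step xy) // sZ // !inE eqxx ?orbT.
case/andP=> xa p sZ xX yX; case: (boolP (a \in X)) => aX.
  by apply/orP; right; apply: IHs p _ aX yX => z zs; apply: sZ; rewrite inE zs orbT.
by rewrite (bd_step xa) // sZ // !inE eqxx ?orbT.
Qed.

Lemma bd_run_rev x s y : path (@adj G) x (rcons s y) ->
    {subset x :: rcons s y <= Z} -> x \notin X -> y \in X ->
  has (mem D) (rcons s y).
Proof.
move=> /rev_adj_path p sZ xX yX.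
have : has (mem D) (y :: rev s).
  apply: bd_run p _ yX xX => z; rewrite -rev_cons => zs; apply: sZ.
  by move: zs; rewrite !(inE, mem_rev, mem_rcons) orbCA.
by rewrite has_rcons /= has_rev.
Qed.

Lemma subpath l1 a l2 b l3 x s : path (@adj G) x s ->
    {subset x :: s <= Z} -> x :: s = l1 ++ a :: rcons l2 b ++ l3 ->
  path (@adj G) a (rcons l2 b) /\ {subset a :: rcons l2 b <= Z}.
Proof.
move=> p sZ e; split; last first.
  by move=> z zs; apply: sZ; rewrite e -cat_cons !mem_cat zs orbT.
have : sorted (@adj G) (x :: s) by [].
by rewrite e -cat_cons => /cat_sorted2[_ /cat_sorted2[]].
Qed.

Section Arc.
Variables (u v : G) (w : seq G).
Hypotheses (pw : path (@adj G) u (rcons w v)) (wZ : {subset u :: rcons w v <= Z}).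

Lemma arc_split w1 y w2 : w = w1 ++ y :: w2 ->
  [/\ path (@adj G) u (rcons w1 y), {subset u :: rcons w1 y <= Z},
      path (@adj G) y (rcons w2 v) & {subset y :: rcons w2 v <= Z}].
Proof.
move=> e; have [|p1 p2] := @subpath [::] u w1 y (rcons w2 v) u (rcons w v) pw wZ.
  by rewrite e /= cat_rcons rcons_cat.
have [|p3 p4] := @subpath (u :: w1) y w2 v [::] u (rcons w v) pw wZ.
  by rewrite e /= cats0 rcons_cat.
by [].
Qed.

(** One vertex of [X] on the arc forces the whole arc and both ends into [X]: a run from it towards
    a missing vertex would meet a boundary vertex inside the arc. *)
Lemma arc_no_bd : count (mem D) w = 0 ->
  count (mem X) w = 0 \/ count (mem X) w = size w /\ (u \in X) && (v \in X).
Proof.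
move=> w0; case: (posnP (count (mem X) w)) => [->|]; first by left.
rewrite -has_count => /hasP[x xw xX]; right.
have wD s : {subset s <= w} -> ~~ has (mem D) s.
  move=> sw; apply/hasPn=> z /sw zw.
  by move/eqP: w0; rewrite eqn0Ngt -has_count => /hasPn/(_ z zw).
have [w1 [w2 e]] : exists w1 w2, w = w1 ++ x :: w2.
  by case/splitPr: xw => w1 w2; exists w1, w2.
have [pl zl pr zr] := arc_split e.
have vX : v \in X.
  apply/negPn/negP=> vX; have /negP[] : ~~ has (mem D) (x :: w2).
    by apply: wD => z zs; rewrite e mem_cat zs orbT.
  exact: bd_run pr zr xX vX.
have uX : u \in X.
  apply/negPn/negP=> uX; have /negP[] : ~~ has (mem D) (rcons w1 x).
    by apply: wD => z; rewrite e mem_rcons mem_cat !inE => /orP[]->; rewrite ?orbT.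
  exact: bd_run_rev pl zl uX xX.
split; last by rewrite uX.
apply/eqP; rewrite -all_count; apply/allP=> y yw.
apply/negPn/negP=> yX; move: yw; rewrite e mem_cat inE => /or3P[yw|/eqP yx|yw].
- have [l1 [l2 e1]] : exists l1 l2, w1 = l1 ++ y :: l2.
    by case/splitPr: yw => l1 l2; exists l1, l2.
  have [|p1 p2] := @subpath (u :: l1) y l2 x [::] u (rcons w1 x) pl zl.
    by rewrite e1 /= cats0 rcons_cat.
  have /negP[] : ~~ has (mem D) (rcons l2 x); last exact: bd_run_rev p1 p2 yX xX.
  apply: wD => z; rewrite e e1 mem_rcons !(mem_cat, inE).
  by case/orP=> ->; rewrite ?orbT.
- by case/negP: yX; rewrite yx.
- have [l1 [l2 e1]] : exists l1 l2, w2 = l1 ++ y :: l2.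
    by case/splitPr: yw => l1 l2; exists l1, l2.
  have [|p1 p2] := @subpath [::] x l1 y (rcons l2 v) x (rcons w2 v) pr zr.
    by rewrite e1 /= cat_rcons rcons_cat.
  have /negP[] : ~~ has (mem D) (x :: l1); last exact: bd_run p1 p2 xX yX.
  apply: wD => z; rewrite e e1 !(mem_cat, inE).
  by case/orP=> ->; rewrite ?orbT.
Qed.

(** From a vertex [x] of [X] the runs to the two outside ends each meet the boundary, and they
    overlap only at [x]; a single boundary vertex must therefore be [x] itself. *)
Lemma arc_out_sub : u \notin X -> v \notin X -> count (mem D) w <= 1 ->
  {in w, forall x, x \in X -> x \in D}.
Proof.
move=> uX vX w1 x xw xX; have [l1 [l2 e]] : exists l1 l2, w = l1 ++ x :: l2.
  by case/splitPr: xw => l1 l2; exists l1, l2.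
have [pl zl pr zr] := arc_split e.
move: w1; rewrite e count_cat /=.
have := bd_run pr zr xX vX; have := bd_run_rev pl zl uX xX.
by rewrite has_rcons /= !has_count; case: (x \in D) => //=; lia.
Qed.

Lemma arc_out : u \notin X -> v \notin X -> count (mem D) w <= 1 ->
  count (mem X) w <= count (mem D) w.
Proof.
move=> uX vX w1; have sub := arc_out_sub uX vX w1.
rewrite -!size_filter.
have -> : [seq x <- w | mem X x] = [seq x <- [seq x <- w | mem D x] | mem X x].
  rewrite -filter_predI; apply: eq_in_filter => x xw /=.
  by case: (boolP (x \in X)) => //= xX; rewrite (sub x).
by rewrite size_filter count_size.
Qed.

(** A missing vertex [y] splits the arc into two runs, each of which leaves [X] at a boundary vertex
    of its own. *)
Lemma arc_in : u \in X -> v \in X -> count (mem X) w < size w ->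
  2 <= (u \in D) + (v \in D) + count (mem D) w.
Proof.
move=> uX vX; rewrite ltn_neqAle -all_count => /andP[/allPn[y yw yX] _].
have [l1 [l2 e]] : exists l1 l2, w = l1 ++ y :: l2.
  by case/splitPr: yw => l1 l2; exists l1, l2.
have [pl zl pr zr] := arc_split e.
have := bd_run pl zl uX yX; have := bd_run_rev pr zr yX vX.
by rewrite has_rcons e count_cat /= !has_count; case: (u \in D); case: (v \in D) => //=; lia.
Qed.

Lemma arc_empty : count (mem X) w = 0 -> 0 < size w ->
  (u \in X -> u \in D) /\ (v \in X -> v \in D).
Proof.
move=> w0 w1.
have wX z : z \in w -> z \notin X.
  by move=> zw; move/eqP: w0; rewrite eqn0Ngt -has_count => /hasPn/(_ z zw).
split=> [uX|vX].
  case: w w1 wX pw wZ => [//|a s] _ wX /= /andP[ua _] sZ.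
  by apply: (bd_step ua) uX (wX a _); rewrite ?sZ // !inE eqxx ?orbT.
case/lastP: w w1 wX pw wZ => [//|s a] _ wX.
rewrite rcons_path last_rcons => /andP[_ av] sZ.
rewrite adj_sym in av; apply: (bd_step av) vX (wX a _).
- by apply: sZ; rewrite inE mem_rcons mem_head orbT.
- by apply: sZ; rewrite inE mem_rcons inE mem_rcons mem_head !orbT.
- by rewrite mem_rcons mem_head.
Qed.

End Arc.

Section Leg.
Variables (u : G) (w : seq G).
Hypotheses (pw : path (@adj G) u w) (wZ : {subset u :: w <= Z}).

Lemma leg_no_bd : count (mem D) w = 0 ->
  count (mem X) w = 0 \/ count (mem X) w = size w /\ u \in X.
Proof.
elim/last_ind: w pw wZ => [|s v _] p sZ; first by left.
rewrite -cats1 !count_cat /= !addn0 => /eqP; rewrite addn_eq0 => /andP[/eqP s0 vD].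
have [e | [-> /andP[uX vX]]] := arc_no_bd p sZ s0; last by right; rewrite vX size_cat.
case: (boolP (v \in X)) => [vX|vX]; last by left; rewrite e.
rewrite e; case: s e {s0} p sZ => [|a s] e p sZ.
  right; move: p; rewrite /= andbT => uv; split=> //.
  apply/negPn/negP=> uX; rewrite adj_sym in uv.
  by rewrite (bd_step uv) // ?sZ // !inE eqxx ?orbT in vD.
have [//|_ /(_ vX) vD'] := arc_empty p sZ e.
by rewrite vD' in vD.
Qed.

Lemma leg_empty : count (mem X) w = 0 -> 0 < size w -> u \in X -> u \in D.
Proof.
case: w pw wZ => [//|a s] /= /andP[ua _] sZ /eqP; rewrite addn_eq0 => /andP[aX _] _ uX.
by apply: (bd_step ua) => //; rewrite ?sZ ?inE ?eqxx ?orbT // -eqb0.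
Qed.

End Leg.

Lemma card_count s : uniq s -> Z = [set z in s] -> #|X :&: Z| = count (mem X) s.
Proof.
move=> us ->; rewrite -size_filter -(card_uniqP (filter_uniq (mem X) us)).
by apply: eq_card => z; rewrite !inE mem_filter.
Qed.

Lemma card_bd s : uniq s -> Z = [set z in s] -> #|D| = count (mem D) s.
Proof.
move=> us eZ; rewrite -size_filter -(card_uniqP (filter_uniq (mem D) us)).
apply: eq_card => z; rewrite mem_filter /=; case: (boolP (z \in D)) => //=.
by rewrite inE eZ !inE => /andP[/andP[_ ->]].
Qed.

End Boundary.

(** Summary of an arc by booleans and numbers alone, so that [lia] can finish the case analysis for
    suns: [U], [V] tell whether the ends are in [X], [dU], [dV] whether they are boundary vertices;
    inside the arc, [c] counts members of [X], [b] boundary vertices and [n] all vertices. *)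
Definition arc_state (U V dU dV : bool) (c b n : nat) : Prop :=
  c <= n /\ [\/ [/\ b = 0, c = 0, U <= dU & V <= dV], [/\ b = 0, c = n, U & V],
    b = 1 /\ (if U then if V then c = n \/ 0 < dU + dV else True
              else if V then True else c <= 1) | 2 <= b].

Definition leg_state (U dU : bool) (c b n : nat) : Prop :=
  c <= n /\ [\/ [/\ b = 0, c = 0 & U <= dU], [/\ b = 0, c = n & U] | 0 < b].

Lemma arcP (G : sgraph) (Z X : {set G}) u v w :
    path (@adj G) u (rcons w v) -> {subset u :: rcons w v <= Z} -> 0 < size w ->
  arc_state (u \in X) (v \in X) (u \in bd Z X) (v \in bd Z X)
    (count (mem X) w) (count (mem (bd Z X)) w) (size w).
Proof.
move=> p sZ w0; split; first exact: count_size.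
have := (arc_no_bd p sZ (X := X), arc_out p sZ (X := X),
         arc_in p sZ (X := X), arc_empty p sZ (X := X)).
have := count_size (mem X) w.
case: (count (mem (bd Z X)) w) => [|[|b]] cn [[[h1 h2] h3] h4].
- case: h1 => // [c0|[cw /andP[uX vX]]]; last by constructor 2.
  have [hu hv] := h4 c0 w0; constructor 1; split=> //.
  + by case: (u \in X) hu => // ->.
  + by case: (v \in X) hv => // ->.
- constructor 3; split=> //; case: (u \in X) h2 h3; case: (v \in X) => h2 h3 //.
    case: (leqP (size w) (count (mem X) w)) => [sc|cs]; first by left; lia.
    by right; have := h3 isT isT cs; lia.
  exact: h2.
- by constructor 4.
Qed.

Lemma legP (G : sgraph) (Z X : {set G}) u w :
    path (@adj G) u w -> {subset u :: w <= Z} -> 0 < size w ->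
  leg_state (u \in X) (u \in bd Z X)
    (count (mem X) w) (count (mem (bd Z X)) w) (size w).
Proof.
move=> p sZ w0; split; first exact: count_size.
have := (leg_no_bd p sZ (X := X), leg_empty p sZ (X := X)).
case: (posnP (count (mem (bd Z X)) w)) => [-> [h1 h2]|b0 _]; last by constructor 3.
case: h1 => // [c0|[cw uX]]; last by constructor 2.
by constructor 1; split=> //; case: (u \in X) (h2 c0 w0) => // ->.
Qed.

(** * Suns *)

Section Sun.
Variables (G : sgraph) (a1 a2 a3 : G) (e12 e23 e31 g1 g2 g3 : seq G).

(* The excess 20 of a leg over the opposite arc is what makes room for the
   window: with arcs of total length [N], a set with at most two boundary
   vertices has at most [N + 20 + O(1)] or at least [N + 40] elements. *)
Lemma sun_bound :
    path (@adj G) a1 (rcons e12 a2) -> path (@adj G) a2 (rcons e23 a3) ->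
    path (@adj G) a3 (rcons e31 a1) ->
    path (@adj G) a1 g1 -> path (@adj G) a2 g2 -> path (@adj G) a3 g3 ->
    uniq ([:: a1; a2; a3] ++ e12 ++ e23 ++ e31 ++ g1 ++ g2 ++ g3) ->
    size g1 = size e23 + 20 -> size g2 = size e31 + 20 ->
    size g3 = size e12 + 20 ->
    40 <= size e12 -> 40 <= size e23 -> 40 <= size e31 ->
  4 <= inspection_number G.
Proof.
move=> p12 p23 p31 q1 q2 q3; set s := _ ++ _ => us s1 s2 s3 n3 n1 n2.
pose Z := [set z in s].
have sub t : {subset t <= s} -> {subset t <= Z} by move=> ts z zt; rewrite in_set; apply: ts.
have [z12 z23 z31] : [/\ {subset a1 :: rcons e12 a2 <= Z},
    {subset a2 :: rcons e23 a3 <= Z} & {subset a3 :: rcons e31 a1 <= Z}].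
  by split; apply: sub => z; rewrite /s !(inE, mem_rcons, mem_cat);
    case/or3P=> ->; rewrite ?orbT.
have [y1 y2 y3] : [/\ {subset a1 :: g1 <= Z}, {subset a2 :: g2 <= Z} &
    {subset a3 :: g3 <= Z}].
  by split; apply: sub => z; rewrite /s !(inE, mem_rcons, mem_cat);
    case/orP=> ->; rewrite ?orbT.
apply: (@window_bound _ Z (size e12 + size e23 + size e31 + 28)); last first.
- have -> : #|Z| = size s by rewrite -(card_uniqP us); apply: eq_card => z; rewrite in_set.
  by rewrite /s !size_cat /=; lia.
- by lia.
move=> X hX; rewrite leqNgt; apply/negP; rewrite ltnS.
rewrite (card_bd X us (erefl Z)); move: hX; rewrite (card_count X us (erefl Z)).
rewrite /s !count_cat /= addn0.
have l12 := arcP X p12 z12; have l23 := arcP X p23 z23; have l31 := arcP X p31 z31.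
have k1 := legP X q1 y1; have k2 := legP X q2 y2; have k3 := legP X q3 y3.
move: l12 l23 l31 k1 k2 k3; rewrite s1 s2 s3 !addn_gt0 !orbT.
move=> /(_ (ltac:(lia))) l12 /(_ (ltac:(lia))) l23 /(_ (ltac:(lia))) l31.
move=> /(_ isT) k1 /(_ isT) k2 /(_ isT) k3.
move: l12 l23 l31 k1 k2 k3 n1 n2 n3; clear.
move: (count (mem X) e12) (count (mem X) e23) (count (mem X) e31)
 (count (mem X) g1) (count (mem X) g2) (count (mem X) g3)
 (count (mem (bd Z X)) e12) (count (mem (bd Z X)) e23) (count (mem (bd Z X)) e31)
 (count (mem (bd Z X)) g1) (count (mem (bd Z X)) g2) (count (mem (bd Z X)) g3)
 (size e12) (size e23) (size e31) => c12 c23 c31 c1 c2 c3 b12 b23 b31 b1 b2 b3 m3 m1 m2.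
move: (a1 \in bd Z X) (a2 \in bd Z X) (a3 \in bd Z X) => d1 d2 d3.
move=> [r12 l12] [r23 l23] [r31 l31] [r1 l1] [r2 l2] [r3 l3] n1 n2 n3 size_X bd_X.
move: l12 l23 l31 l1 l2 l3 size_X.
(* Let [N] be the total length of the arcs. With none of the three joints in [X], two boundary
   vertices pay, up to single vertices, for one arc or two legs, at most [N] as arcs have length at
   least 40. With one joint, [X] has at most [N + 21] vertices, reached by filling its leg and the
   two adjacent arcs. With two or three, the same counts bound what [X] misses among [2 * N + 63]
   vertices. The window from [N + 28] to [N + 30] is never hit. *)
case: (a1 \in X); case: (a2 \in X); case: (a3 \in X) => /=.
all: case=> [[? ? ? ?]|[? ? ? ?]|[? ?]|?] //.
all: case=> [[? ? ? ?]|[? ? ? ?]|[? ?]|?] //; try (exfalso; lia).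
all: case=> [[? ? ? ?]|[? ? ? ?]|[? ?]|?] //; try (exfalso; lia).
all: case=> [[? ? ?]|[? ? ?]|?] //; try (exfalso; lia).
all: case=> [[? ? ?]|[? ? ?]|?] //; try (exfalso; lia).
all: case=> [[? ? ?]|[? ? ?]|?] //; lia.
Qed.
End Sun.

(** * Necklaces *)

Lemma uniq_flatten_map (T S : eqType) (f : T -> seq S) (s : seq T) :
    uniq s -> {in s, forall x, uniq (f x)} ->
    {in s &, forall x y z, x != y -> z \in f x -> z \notin f y} ->
  uniq (flatten (map f s)).
Proof.
elim: s => //= x s IHs /andP[xs us] uf df; rewrite cat_uniq uf ?mem_head //=.
rewrite IHs ?andbT //; first last.
- by move=> y z ys zs; apply: df; rewrite inE ?ys ?zs orbT.
- by move=> y ys; apply: uf; rewrite inE ys orbT.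
apply/hasPn=> z /flatten_mapP[y ys zy]; apply: df zy; rewrite ?inE ?eqxx ?ys ?orbT //.
by apply: contraNneq xs => <-.
Qed.

Lemma iter_ordS k n (i : 'I_k) : iter n (@ordS k) i = (i + n) %% k :> nat.
Proof.
elim: n => [|n IHn] /=; first by rewrite addn0 modn_small.
by rewrite IHn -addn1 modnDml addn1 addnS.
Qed.

Lemma iter_ordS_size k (i : 'I_k) : iter k (@ordS k) i = i.
Proof. by apply: val_inj; rewrite /= iter_ordS modnDr modn_small. Qed.

Lemma traject_ordS_uniq k (i : 'I_k) : uniq (traject (@ordS k) i k).
Proof.
case: k i => [[]//|n] i; rewrite looping_uniq; apply/negP=> /trajectP[m mn].
move/(congr1 (@nat_of_ord _)); rewrite !iter_ordS => /eqP.
rewrite eqn_modDl !modn_small //; lia.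
Qed.

Lemma mem_traject_ordS k (i j : 'I_k) : j \in traject (@ordS k) i k.
Proof.
have [] := @uniq_min_size _ (traject (@ordS k) i k) (enum 'I_k) (traject_ordS_uniq i).
- by move=> z _; rewrite mem_enum.
- by rewrite size_traject -cardE card_ord.
by move=> _ ->; rewrite mem_enum.
Qed.

(** The lists [w i true] and [w i false] hold the interior vertices of the two sides of bead [i],
    between the joints [c i] and [c (ordS i)]; an empty list is a side consisting of one edge. *)
Definition necklace (G : sgraph) k (c : 'I_k -> G) (w : 'I_k -> bool -> seq G) :=
  [/\ injective c,
      forall i b, path (@adj G) (c i) (rcons (w i b) (c (ordS i))),
      forall i b, uniq (w i b),
      forall i b j, c j \notin w i b &
      forall i b i' b' z, (i, b) != (i', b') -> z \in w i b -> z \notin w i' b'].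

Section Ring.
Variables (G : sgraph) (k : nat) (c : 'I_k -> G) (w : 'I_k -> bool -> seq G).

Definition ring (i : 'I_k) (s : 'I_k -> bool) : seq G :=
  flatten [seq c j :: w j (s j) | j <- traject (@ordS k) i k].

Definition necklace_verts : seq G :=
  map c (enum 'I_k) ++ flatten [seq w e.1 e.2 | e <- enum {: 'I_k * bool}].

Hypothesis N : necklace c w.

Lemma flatten_path i n s : path (@adj G) (c i)
  (rcons (w i (s i) ++
          flatten [seq c j :: w j (s j) | j <- traject (@ordS k) (ordS i) n])
    (c (iter n.+1 (@ordS k) i))).
Proof.
have [_ pw _ _ _] := N; elim: n i => [|n IHn] i; first by rewrite cats0.
rewrite trajectS iterSr /= -cat_rcons rcons_cat cat_path pw last_rcons.
exact: IHn.
Qed.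

Lemma ring_path i s : exists2 r, ring i s = c i :: w i (s i) ++ r &
  path (@adj G) (c i) (rcons (w i (s i) ++ r) (c i)).
Proof.
have k0 : 0 < k by apply: leq_ltn_trans (ltn_ord i).
exists (flatten [seq c j :: w j (s j) | j <- traject (@ordS k) (ordS i) k.-1]).
  by rewrite /ring; have -> : traject (@ordS k) i k = i :: traject (@ordS k) (ordS i) k.-1
    by rewrite -trajectS prednK.
by have := flatten_path i k.-1 s; rewrite prednK // iter_ordS_size.
Qed.

Lemma mem_ring i s z :
  (z \in ring i s) = [exists j, (z == c j) || (z \in w j (s j))].
Proof.
apply/flatten_mapP/existsP => [[j _]|[j zj]]; exists j; rewrite ?mem_traject_ordS //;
  by rewrite inE in zj *.
Qed.

Lemma ring_uniq i s : uniq (ring i s).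
Proof.
have [ci _ uw cw dw] := N.
apply: uniq_flatten_map; first exact: traject_ordS_uniq.
  by move=> j _; rewrite /= cw uw.
move=> j l _ _ z jl; rewrite !inE => /orP[/eqP->|zj].
  by rewrite (inj_eq ci) negb_or jl cw.
apply/norP; split; first by apply: contraTneq zj => ->; rewrite cw.
by apply: dw zj; rewrite xpair_eqE negb_and jl.
Qed.

Lemma necklace_verts_uniq : uniq necklace_verts.
Proof.
have [ci _ uw cw dw] := N.
rewrite cat_uniq map_inj_uniq ?enum_uniq //=; apply/andP; split.
  by apply/hasPn=> z /flatten_mapP[e _ ze]; apply/mapP=> -[j _ zj]; move: ze; rewrite zj (negPf (cw _ _ _)).
apply: uniq_flatten_map; rewrite ?enum_uniq // => -[i b] [i' b'] _ _ z /=.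
exact: dw.
Qed.

Lemma mem_necklace_verts z : (z \in necklace_verts) =
  [exists j, z == c j] || [exists e, z \in w e.1 e.2].
Proof.
rewrite mem_cat; congr orb.
  by apply/mapP/existsP => [[j _ ->]|[j /eqP->]]; exists j; rewrite ?mem_enum.
by apply/flatten_mapP/existsP => [[e _ ze]|[e ze]]; exists e; rewrite ?mem_enum.
Qed.

Lemma count_necklace_verts (a : pred G) : count a necklace_verts =
  #|[set i | a (c i)]| + \sum_e count a (w e.1 e.2).
Proof.
rewrite count_cat count_map; congr addn.
  rewrite -sum1_card -sum1_count big_enum_cond /=.
  by apply: eq_bigl => i; rewrite inE.
rewrite count_flatten -map_comp sumnE big_map big_enum.
by apply: eq_bigr.
Qed.


Local Notation Z := [set z in necklace_verts].

Lemma mem_side i b : {subset c i :: rcons (w i b) (c (ordS i)) <= Z}.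
Proof.
move=> z; rewrite inE mem_rcons !inE mem_necklace_verts => /or3P[/eqP->|/eqP->|zw].
- by apply/orP; left; apply/existsP; exists i.
- by apply/orP; left; apply/existsP; exists (ordS i).
- by apply/orP; right; apply/existsP; exists (i, b).
Qed.

Lemma ordS_neq (i : 'I_k) : 1 < k -> ordS i != i.
Proof.
move=> k1; apply/eqP=> /(congr1 val) /= e; have lik := ltn_ord i.
case: (ltnP i.+1 k) => [ik|ki]; first by rewrite modn_small // in e; lia.
have ek : i.+1 = k by lia.
by rewrite ek modnn in e; lia.
Qed.

(* Removing the side [e] leaves a cycle with ears attached at distinct vertices,
   which has no cut vertex; so the single boundary vertex remaining there bounds
   either at most one vertex or everything. *)
Lemma interior_bd_small_or_large (X : {set G}) e y :
    1 < k -> #|bd Z X| <= 2 -> y \in bd Z X -> y \in w e.1 e.2 ->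
  #|X :&: Z| <= (size (w e.1 e.2)).+1 \/ #|Z| <= #|X :&: Z| + size (w e.1 e.2).
Proof.
move=> k1 D2 yD yw; have [ci pw uw cw dw] := N; set W := w e.1 e.2 in yw *.
have szW : #|[set z in W]| = size W.
  by rewrite -(card_uniqP (uw e.1 e.2)); apply: eq_card => z; rewrite inE.
(* [y] takes one of the two boundary vertices, so at most one lies outside the side [W]. *)
have one z z' : z \in bd Z X -> z' \in bd Z X -> z \notin W -> z' \notin W -> z = z'.
  move=> zD zD' zW zW'; apply: contraTeq D2 => zz'; rewrite -ltnNge.
  have yz : y != z by apply: contraNneq zW => <-.
  have yz' : y != z' by apply: contraNneq zW' => <-.
  have : [set y; z; z'] \subset bd Z X.
    by apply/subsetP=> x; rewrite !inE -orbA => /or3P[] /eqP->; move: yD zD zD'; rewrite !inE.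
  move/subset_leq_card; apply: leq_trans.
  by rewrite setUC !cardsU1 cards1 !inE negb_or !(eq_sym z') yz' zz' yz.
have cnt1 s : uniq s -> {in s, forall z, z \notin W} -> count (mem (bd Z X)) s <= 1.
  move=> us sW; rewrite -size_filter.
  have := filter_uniq (mem (bd Z X)) us.
  case e1: (filter _ _) => [|a [|b l]] //=; rewrite inE negb_or => /andP[/andP[/eqP ab0 _] _]; case: ab0.
  have ab z : z \in [:: a, b & l] -> z \in bd Z X /\ z \notin W.
    by rewrite -e1 mem_filter => /andP[? /sW].
  have [aD aW] := ab a (mem_head _ _).
  have [bD bW] : b \in bd Z X /\ b \notin W by apply: ab; rewrite !inE eqxx orbT.
  exact: one.
(* A ring that avoids [W]: the opposite side at the bead of [e], an arbitrary side elsewhere. *)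
pose s j := if j == e.1 then ~~ e.2 else false.
have sW j b : (j, b) != e -> {in w j b, forall z, z \notin W}.
  by move=> ne z; apply: dw; rewrite -surjective_pairing.
have se j : (j, s j) != e.
  rewrite [X in _ != X]surjective_pairing xpair_eqE /s; case: (eqVneq j e.1) => //= _.
  by case: e.2.
have cW j : c j \notin W by apply: cw.
have inR j : c j \in ring e.1 s.
  by rewrite mem_ring; apply/existsP; exists j; rewrite eqxx.
have RZ : {subset ring e.1 s <= Z}.
  move=> z; rewrite mem_ring inE mem_necklace_verts => /existsP[j /orP[/eqP->|zw']].
    by apply/orP; left; apply/existsP; exists j.
  by apply/orP; right; apply/existsP; exists (j, s j).
have RW : {in ring e.1 s, forall z, z \notin W}.
  by move=> z; rewrite mem_ring => /existsP[j /orP[/eqP->//|]]; apply: sW.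
have ZE z : z \in Z -> z \notin W -> z \in ring e.1 s \/
    exists2 f, f != e & z \in w f.1 f.2.
  rewrite inE mem_necklace_verts => /orP[/existsP[j /eqP-> _]|/existsP[f zf] zW]; first by left.
  by right; exists f => //; apply: contraNneq zW => fe; rewrite /W -fe.
(* If the ring lies in [X], so does everything outside [W], because a side with a missing vertex and
   both ends in [X] costs two boundary vertices. *)
case: (boolP (all (mem X) (ring e.1 s))) => [/allP RX|/allPn[y0 y0R y0X]].
  right; rewrite -szW; apply: leq_trans (leq_card_setU _ _).1.
  apply/subset_leq_card/subsetP => z zZ; rewrite in_setU in_setI zZ andbT.
  case: (boolP (z \in W)) => zW; first by rewrite inE zW orbT.
  case: (boolP (z \in X)) => //= zX; exfalso.
  have [/RX|[[j b] /= ne zw]] := ZE z zZ zW; first by rewrite /= (negPf zX).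
  have := arc_in (pw j b) (@mem_side j b) (RX _ (inR _)) (RX _ (inR _)).
  rewrite ltn_neqAle -all_count count_size andbT => arc2.
  have {}arc2 : 2 <= (c j \in bd Z X) + (c (ordS j) \in bd Z X) + count (mem (bd Z X)) (w j b).
    by apply: arc2; apply/negP=> /allP/(_ z zw); rewrite /= (negPf zX).
  move: arc2.
  have : count (mem (bd Z X)) (c j :: rcons (w j b) (c (ordS j))) <= 1.
    apply: cnt1; last by move=> x; rewrite inE mem_rcons inE => /or3P[/eqP->|/eqP->|/sW]; auto.
    rewrite /= mem_rcons inE negb_or rcons_uniq uw !cw !andbT.
    by rewrite (inj_eq ci) eq_sym ordS_neq.
  by rewrite /= -cats1 count_cat /=; lia.
have [n r rot_r] := rot_to y0R.
have cyc : cycle (@adj G) (y0 :: r).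
  rewrite -rot_r rot_cycle; have [r' -> p'] := ring_path e.1 s.
  exact: p'.
have ur : uniq (y0 :: r) by rewrite -rot_r rot_uniq ring_uniq.
have mr z : (z \in y0 :: r) = (z \in ring e.1 s) by rewrite -rot_r mem_rot.
(* Cut open at the vertex [y0] outside [X], the ring is an arc with both ends outside [X] and at
   most one boundary vertex. *)
have RD x : x \in ring e.1 s -> x \in X -> x \in bd Z X.
  move=> xR xX; have xr : x \in r.
    by move: xR; rewrite -mr inE => /orP[/eqP xy|//]; rewrite -xy /= xX in y0X.
  apply: (@arc_out_sub _ Z X y0 y0 r) => //.
    by move=> z; rewrite in_cons mem_rcons in_cons orbA orbb -in_cons mr; apply: RZ.
  apply: cnt1; first by case/andP: ur.
  by move=> z zr; apply: RW; rewrite -mr inE zr orbT.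
(* On a side other than [e], an end in [X] is already the one boundary vertex outside [W], so the
   side has none inside; as [X] meets it, both of its ends would be in [X], giving two. Hence both
   ends are outside and [arc_out_sub] applies again. *)
have XD x : x \in X -> x \in Z -> x \notin W -> x \in bd Z X.
  move=> xX xZ xW; have [/RD|[[j b] /= ne xw]] := ZE x xZ xW; first exact.
  have noX j' : c j' \in X -> count (mem (bd Z X)) (w j b) = 0.
    move=> jX; apply/eqP; rewrite eqn0Ngt -has_count; apply/hasPn=> z zw.
    apply/negP=> zD; have := one z _ zD (RD _ (inR j') jX) (sW _ _ ne _ zw) (cW _).
    by move=> zc; have := cw j b j'; rewrite -zc zw.
  have hX j' : c j' \in X -> count (mem (bd Z X)) (w j b) = 0 -> x \in bd Z X.
    move=> _ h0; case: (arc_no_bd (pw j b) (@mem_side j b) h0) => [/eqP|[_ /andP[uX vX]]].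
      by rewrite eqn0Ngt -has_count => /hasPn/(_ x xw); rewrite /= xX.
    have /ci/eqP := one _ _ (RD _ (inR j) uX) (RD _ (inR (ordS j)) vX) (cW _) (cW _).
    by rewrite eq_sym (negPf (ordS_neq j k1)).
  case: (boolP (c j \in X)) => uX; first exact: hX uX (noX _ uX).
  case: (boolP (c (ordS j) \in X)) => vX; first exact: hX vX (noX _ vX).
  apply: (arc_out_sub (pw j b) (@mem_side j b) uX vX _ xw xX).
  by apply: cnt1 => [|z]; [apply: uw | apply: sW].
left; rewrite -szW -add1n.
have sub : X :&: Z \subset (X :&: Z :\: [set z in W]) :|: [set z in W].
  by apply/subsetP=> z zXZ; rewrite in_setU in_setD zXZ andbT orNb.
apply: leq_trans (subset_leq_card sub) _.
apply: leq_trans (leq_card_setU _ _).1 _; rewrite leq_add2r.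
apply/card_le1_eqP=> x x'; rewrite !in_setD !in_setI => /andP[xW /andP[xX xZ]].
move=> /andP[xW' /andP[xX' xZ']].
by rewrite inE in xW; rewrite inE in xW'; apply: one => //; apply: XD.
Qed.

(* A set with at most two boundary vertices, none of them inside a side, is a
   union of joints and whole sides, so its size is one of [2 ^ (3 * k)] values;
   hence some window between the small and the large sizes avoids them all. *)
Lemma necklace_sparse_bound T :
    1 < k -> (forall i b, size (w i b) <= T) ->
    2 * T + 3 * 2 ^ (3 * k) + 10 <= size necklace_verts ->
  4 <= inspection_number G.
Proof.
move=> k1 wT big.
have cardZ : #|Z| = size necklace_verts.
  by rewrite -(card_uniqP necklace_verts_uniq); apply: eq_card => z; rewrite inE.
pose P := ({set 'I_k} * {set 'I_k * bool})%type.
pose g (p : P) := #|p.1| + \sum_(e in p.2) size (w e.1 e.2).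
have cardP : #|{: P}| = 2 ^ (3 * k).
  rewrite card_prod -!cardsT -!powersetT !card_powerset !cardsT card_prod card_ord card_bool.
  by rewrite -expnD; congr (_ ^ _); lia.
(* Pigeonhole: [2 ^ (3 * k) + 1] disjoint windows of width three above [T + 1], against
   [2 ^ (3 * k)] arguments of [g]. All windows end below [#|Z| - T], so sets with a boundary vertex
   inside a side miss them too. *)
have [j jP] : exists j : 'I_(2 ^ (3 * k)).+1,
    forall p : P, ~~ (T + 2 + 3 * j <= g p <= T + 2 + 3 * j + 2).
  apply: contrapT => nj.
  have h (j : 'I_(2 ^ (3 * k)).+1) : exists p : P, T + 2 + 3 * j <= g p <= T + 2 + 3 * j + 2.
    apply: contrapT => np; apply: nj; exists j => p.
    by apply/negP=> gp; apply: np; exists p.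
  have [f fP] := choice h.
  have : injective f.
    move=> j j' ff; apply: val_inj => /=; have := fP j; have := fP j'; rewrite ff; lia.
  by move/leq_card; rewrite cardP card_ord ltnn.
apply: (@window_bound _ Z (T + 2 + 3 * j)); first last.
- by rewrite cardZ; have := ltn_ord j; lia.
- by lia.
move=> X hX; rewrite leqNgt; apply/negP; rewrite ltnS => D2.
have cardX := card_count X necklace_verts_uniq (erefl Z).
case: (pselect (exists e, has (mem (bd Z X)) (w e.1 e.2))) => [[e /hasP[y yw yD]]|nD].
  have := interior_bd_small_or_large k1 D2 yD yw; have := wT e.1 e.2; have := ltn_ord j.
  by rewrite cardZ; lia.
(* Without boundary vertices inside sides, [X] contains every side it meets, so [g p] is its
   size. *)
pose p : P := ([set i | c i \in X], [set e | has (mem X) (w e.1 e.2)]).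
have /negP[] := jP p; rewrite (_ : g p = #|X :&: Z|) // cardX count_necklace_verts /g /=.
congr addn; rewrite big_mkcond /=; apply: eq_bigr => e _; rewrite inE.
have [_ pw _ _ _] := N.
have : count (mem (bd Z X)) (w e.1 e.2) = 0.
  by apply/eqP; rewrite eqn0Ngt -has_count; apply/negP=> h; apply: nD; exists e.
case/(arc_no_bd (pw e.1 e.2) (@mem_side e.1 e.2)) => [e0|[es _]].
  by rewrite has_count e0.
by rewrite has_count es; case: posnP => [->|].
Qed.

End Ring.

(** * Two linked necklaces *)

(** For the long side of a bead: its two ends, each read towards the middle, supply two disjoint
    legs. *)
Lemma uniq_take_rev (T : eqType) (t : seq T) m n :
  uniq t -> m + n <= size t -> uniq (take m t ++ take n (rev t)).
Proof.
move=> ut mn; have: uniq (take m t ++ drop (size t - n) t).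
  apply: subseq_uniq ut; rewrite -[X in subseq _ X](cat_take_drop m t); apply: cat_subseq => //.
  have -> : size t - n = size t - n - m + m by lia.
  by rewrite -drop_drop drop_subseq.
by rewrite take_rev !cat_uniq rev_uniq has_rev.
Qed.

Section Leg.
Variables (G : sgraph) (k : nat) (c : 'I_k -> G) (w : 'I_k -> bool -> seq G).
Hypothesis N : necklace c w.

Lemma ring_split (b v : 'I_k) s : v != b -> v != ordS b ->
  exists r1 r2, let A := w (ordS b) (s (ordS b)) ++ r1 in let B := w v (s v) ++ r2 in
    ring c w (ordS b) s = c (ordS b) :: A ++ c v :: B ++ c b :: w b (s b).
Proof.
move=> vb vm; have k0 : 0 < k by apply: leq_ltn_trans (ltn_ord b).
have hb : iter k.-1 (@ordS k) (ordS b) = b.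
  by rewrite -iterSr prednK // iter_ordS_size.
have e : traject (@ordS k) (ordS b) k = rcons (traject (@ordS k) (ordS b) k.-1) b.
  by rewrite -[X in rcons _ X]hb -trajectSr prednK.
have vt : v \in traject (@ordS k) (ordS b) k.-1.
  by have := mem_traject_ordS (ordS b) v; rewrite e mem_rcons inE (negPf vb).
rewrite /ring e; case: (k.-1) vt => [//|n]; rewrite trajectS inE (negPf vm) /=.
case/splitPr => l1 l2.
exists (flatten [seq c j :: w j (s j) | j <- l1]).
exists (flatten [seq c j :: w j (s j) | j <- l2]).
by rewrite /= map_rcons flatten_rcons map_cat flatten_cat /= -!catA /= -!catA.
Qed.

Lemma size_ring i s : size (ring c w i s) = k + \sum_j size (w j (s j)).
Proof.
rewrite size_flatten /shape -map_comp sumnE big_map.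
have p : perm_eq (traject (@ordS k) i k) (enum 'I_k).
  apply: uniq_perm; rewrite ?traject_ordS_uniq ?enum_uniq // => j.
  by rewrite mem_traject_ordS mem_enum.
rewrite (perm_big _ p) big_enum /= (eq_bigr (fun j => 1 + size (w j (s j)))) //.
by rewrite big_split /= sum1_card card_ord.
Qed.

(** The leg at [c (ordS b)] faces the arc [B], the leg at [c b] faces [A], and [leg], which starts
    at [c v], faces the chosen side of [b]. The first two are cut from the opposite side [t] of [b],
    which has room because [A] and [B] together are no longer than [k] plus the chosen sides of the
    other beads. *)
Lemma leg_bound (b v : 'I_k) s leg :
    v != b -> v != ordS b -> (forall i b, 40 <= size (w i b)) ->
    path (@adj G) (c v) leg -> uniq leg ->
    {in leg, forall z, z \notin necklace_verts c w} ->
    size (w b (s b)) + 20 <= size leg ->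
    k + \sum_(j < k | j != b) size (w j (s j)) + 40 <= size (w b (~~ s b)) ->
  4 <= inspection_number G.
Proof.
move=> vb vm w40 pl ul dl sl big; have [ci pw uw cw dw] := N.
have [r1 [r2]] := ring_split s vb vm.
set A := w _ _ ++ r1; set B := w v _ ++ r2 => /= ringE.
set t := w b (~~ s b) in big.
have sA : 40 <= size A by rewrite size_cat; have := w40 (ordS b) (s (ordS b)); lia.
have sB : 40 <= size B by rewrite size_cat; have := w40 v (s v); lia.
move: A B ringE sA sB => A B ringE sA sB.
have szAB : size A + size B + 40 <= size t.
  have := size_ring (ordS b) s; rewrite ringE /= !size_cat /= size_cat /= (bigD1 b) //=.
  by move: big; set S1 := bigop _ _ _; lia.
have [r rE] := ring_path N (ordS b) s.
rewrite ringE in rE; case: rE => <-.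
rewrite -cat_rcons -cat_rcons !rcons_cat !cat_path !last_rcons => /and3P[pA pB pW].
have pt := pw b (~~ s b).
apply: (@sun_bound G (c (ordS b)) (c v) (c b) A B (w b (s b))
  (take (size B + 20) (rev t)) (take (size (w b (s b)) + 20) leg)
  (take (size A + 20) t)) => //.
- have := rev_adj_path pt; rewrite -cats1 cat_path => /andP[+ _].
  by rewrite -{1}(cat_take_drop (size B + 20) (rev t)) cat_path => /andP[].
- by move: pl; rewrite -{1}(cat_take_drop (size (w b (s b)) + 20) leg) cat_path => /andP[].
- move: pt; rewrite -cats1 cat_path -/t => /andP[+ _].
  by rewrite -{1}(cat_take_drop (size A + 20) t) cat_path => /andP[].
- set g1 := take _ _; set g2 := take _ _; set g3 := take _ _.
  have p : perm_eq ([:: c (ordS b); c v; c b] ++ A ++ B ++ w b (s b) ++ g1 ++ g2 ++ g3)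
      (ring c w (ordS b) s ++ (g3 ++ g1) ++ g2).
    apply/permP => a; rewrite ringE /= !count_cat /= !count_cat /=.
    move: (count a A) (count a B) (count a (w b (s b))) (count a g1) (count a g2).
    by move: (count a g3) (a (c v)) (a (c b)) (a (c (ordS b))); clear; lia.
  rewrite (perm_uniq p) !(cat_uniq (ring _ _ _ _)) ring_uniq //=.
  have g31 z : z \in g3 ++ g1 -> z \in t.
    by rewrite mem_cat => /orP[/mem_take//|/mem_take]; rewrite mem_rev.
  have t_ring z : z \in t -> z \notin ring c w (ordS b) s.
    move=> zt; rewrite mem_ring; apply/existsP=> -[j /orP[/eqP zj|zj]].
      by move: zt; rewrite zj (negPf (cw _ _ _)).
    have ne : (b, ~~ s b) != (j, s j).
      by apply/eqP=> -[->]; case: (s j).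
    by have := dw _ _ _ _ _ ne zt; rewrite zj.
  have leg_ring z : z \in g2 -> z \notin ring c w (ordS b) s /\ z \notin t.
    move/mem_take/dl; rewrite mem_necklace_verts negb_or => /andP[/existsPn zc /existsPn zw].
    split; last exact: (zw (b, ~~ s b)).
    rewrite mem_ring; apply/existsPn=> j.
    by rewrite negb_or zc (zw (j, s j)).
  apply/andP; split.
    apply/hasPn=> z; rewrite mem_cat => /orP[/g31/t_ring//|/leg_ring[]//].
  rewrite cat_uniq uniq_take_rev ?uw ?take_uniq //=; last by rewrite addnACA [20 + 20]/=.
  rewrite andbT; apply/hasPn=> z /leg_ring[_]; apply: contra.
  exact: g31.
- by rewrite size_take size_rev; case: ifP => //; lia.
- by rewrite size_take; case: ifP => //; lia.
- by rewrite size_take; case: ifP => //; lia.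
Qed.

(** Let [T] be the length of the longest side, on bead [b]. As [b] does not dominate, the short
    sides of the other beads total more than [T - k - 40], and so do their long sides: the necklace
    has roughly [3 * T] vertices or more. The third [T] pays for the constants of
    [necklace_sparse_bound]. *)
Lemma undominated_bound (s : 'I_k -> bool) : 1 < k ->
    (forall i b, 3 * 2 ^ (3 * k) + k + 100 <= size (w i b)) ->
    (forall j, size (w j (s j)) <= size (w j (~~ s j))) ->
    (forall b, size (w b (~~ s b)) <
               k + \sum_(j < k | j != b) size (w j (s j)) + 40) ->
  4 <= inspection_number G.
Proof.
move=> k1 wL short und; pose T := \max_j size (w j (~~ s j)).
have [b Tb] : {b : 'I_k | T = size (w b (~~ s b))}.
  by apply: eq_bigmax; rewrite card_ord; lia.
have leT j : size (w j (~~ s j)) <= T by exact: (leq_bigmax j).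
apply: (@necklace_sparse_bound _ _ _ _ N T) => //.
  move=> i x; case: (boolP (x == s i)) => [/eqP->|xs].
    exact: leq_trans (short i) (leT i).
  by have -> : x = ~~ s i by case: x (s i) xs => [] [].
have -> : size (necklace_verts c w) =
    k + \sum_j (size (w j (s j)) + size (w j (~~ s j))).
  rewrite -count_predT count_necklace_verts; congr addn.
    by rewrite (_ : [set i | predT (c i)] = setT) ?cardsT ?card_ord //; apply/setP=> i; rewrite !inE.
  rewrite -(pair_bigA _ (fun i x => count predT (w i x))) /=; apply: eq_bigr => j _.
  by rewrite big_bool /= !count_predT; case: (s j) => //=; lia.
rewrite (bigD1 b) //= big_split /= -Tb; have := und b; rewrite -Tb.
have : \sum_(j < k | j != b) size (w j (s j)) <= \sum_(j < k | j != b) size (w j (~~ s j)).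
  by apply: leq_sum => j _.
have := wL b (~~ s b); rewrite -Tb; set S1 := bigop _ _ _; set S2 := bigop _ _ _.
by move: S1 S2 (T) (2 ^ (3 * k)) => S1 S2 T' E; lia.
Qed.

End Leg.

Section Linked.
Variables (G : sgraph) (k1 k2 : nat).
Variables (c1 : 'I_k1 -> G) (w1 : 'I_k1 -> bool -> seq G).
Variables (c2 : 'I_k2 -> G) (w2 : 'I_k2 -> bool -> seq G).

Definition link (x : 'I_k1) (y : 'I_k2) (p : seq G) :=
  [/\ path (@adj G) (c1 x) (rcons p (c2 y)), uniq p,
      {in p, forall z, z \notin necklace_verts c1 w1} &
      {in p, forall z, z \notin necklace_verts c2 w2}].

(** The third leg is a link followed by a whole ring of the other necklace. The ring contains side
    [s2 b2] of [b2], hence is at least as long as the arc [w1 b1 (s1 b1)], and the link gives the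
    excess 20. *)
Lemma dominated_bound (b1 : 'I_k1) s1 s2 x x' y y' p p' (b2 : 'I_k2) :
    necklace c1 w1 -> necklace c2 w2 ->
    {in necklace_verts c2 w2, forall z, z \notin necklace_verts c1 w1} ->
    x != x' -> ordS x != x' -> ordS x' != x -> link x y p -> link x' y' p' ->
    (forall i b, 40 <= size (w1 i b)) -> 20 <= size p -> 20 <= size p' ->
    k1 + \sum_(j < k1 | j != b1) size (w1 j (s1 j)) + 40 <= size (w1 b1 (~~ s1 b1)) ->
    size (w1 b1 (s1 b1)) <= size (w2 b2 (s2 b2)) ->
  4 <= inspection_number G.
Proof.
move=> N1 N2 dN xx xx1 xx2 lp lp' w40 sp sp' dom le12.
(* The joints [x] and [x'] are not consecutive, so they cannot both be ends of bead [b1]; the leg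
   starts from one that is not. *)
have [v [u [q [vb vm [pq uq dq1 dq2] sq]]]] : exists v u q,
    [/\ v != b1, v != ordS b1, link v u q & 20 <= size q].
  case: (boolP ((x == b1) || (x == ordS b1))) => [xb|]; last first.
    by rewrite negb_or => /andP[xb xb']; exists x, y, p.
  exists x', y', p'; split=> //.
    case/orP: xb => /eqP xb; first by rewrite -xb eq_sym.
    by apply: contraNneq xx2 => ->; rewrite xb.
  case/orP: xb => /eqP xb; last by rewrite -xb eq_sym.
  by rewrite -xb eq_sym.
have [r ringE pr] := ring_path N2 u s2.
have ur := ring_uniq N2 u s2.
have ring_verts z : z \in ring c2 w2 u s2 -> z \in necklace_verts c2 w2.
  rewrite mem_ring mem_necklace_verts => /existsP[j /orP[zj|zj]].
    by apply/orP; left; apply/existsP; exists j.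
  by apply/orP; right; apply/existsP; exists (j, s2 j).
apply: (@leg_bound _ _ _ _ N1 b1 v s1 (q ++ ring c2 w2 u s2)) => //.
- rewrite ringE -cat_rcons cat_path pq last_rcons.
  by move: pr; rewrite -cats1 cat_path => /andP[].
- rewrite cat_uniq uq ur andbT /=; apply/hasPn=> z /ring_verts; apply: contraL.
  exact: dq2.
- by move=> z; rewrite mem_cat => /orP[/dq1//|/ring_verts/dN].
- rewrite size_cat size_ring (bigD1 b2) //=; lia.
Qed.

End Linked.

Lemma link_rev G k1 k2 c1 w1 c2 w2 x y p :
  @link G k1 k2 c1 w1 c2 w2 x y p -> link c2 w2 c1 w1 y x (rev p).
Proof.
case=> pp up d1 d2; split; first exact: rev_adj_path.
- by rewrite rev_uniq.
- by move=> z; rewrite mem_rev => /d2.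
- by move=> z; rewrite mem_rev => /d1.
Qed.

Lemma linked_necklaces_bound (G : sgraph) k1 k2 (c1 : 'I_k1 -> G) w1
    (c2 : 'I_k2 -> G) w2 x x' y y' p p' :
    1 < k1 -> 1 < k2 -> necklace c1 w1 -> necklace c2 w2 ->
    {in necklace_verts c2 w2, forall z, z \notin necklace_verts c1 w1} ->
    x != x' -> ordS x != x' -> ordS x' != x ->
    y != y' -> ordS y != y' -> ordS y' != y ->
    link c1 w1 c2 w2 x y p -> link c1 w1 c2 w2 x' y' p' ->
    (forall i b, 3 * 2 ^ (3 * k1) + k1 + 100 <= size (w1 i b)) ->
    (forall i b, 3 * 2 ^ (3 * k2) + k2 + 100 <= size (w2 i b)) ->
    20 <= size p -> 20 <= size p' ->
  4 <= inspection_number G.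
Proof.
move=> k1_gt1 k2_gt1 N1 N2 dN xx xx1 xx2 yy yy1 yy2 lp lp' L1 L2 sp sp'.
(* [s] selects the shorter side of each bead, so [dom] below compares the longer side of [b] with
   the short sides of all other beads. *)
pose s k (w : 'I_k -> bool -> seq G) j := size (w j true) < size (w j false).
have short k (w : 'I_k -> bool -> seq G) j : size (w j (s k w j)) <= size (w j (~~ s k w j)).
  by rewrite /s; case: ltnP => //=; lia.
pose dom k (w : 'I_k -> bool -> seq G) b :=
  k + \sum_(j < k | j != b) size (w j (s k w j)) + 40 <= size (w b (~~ s k w b)).
have [[b1 d1]|/forallNP nd1] := pselect (exists b, dom _ w1 b); last first.
  apply: (undominated_bound N1 k1_gt1 L1 (short _ w1)) => b.
  by rewrite ltnNge; apply/negP/nd1.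
have [[b2 d2]|/forallNP nd2] := pselect (exists b, dom _ w2 b); last first.
  apply: (undominated_bound N2 k2_gt1 L2 (short _ w2)) => b.
  by rewrite ltnNge; apply/negP/nd2.
case: (leqP (size (w1 b1 (s _ w1 b1))) (size (w2 b2 (s _ w2 b2)))) => [le|/ltnW le].
  apply: (dominated_bound N1 N2 dN xx xx1 xx2 lp lp' _ sp sp' d1 le).
  by move=> i b; have := L1 i b; lia.
apply: (dominated_bound N2 N1 _ yy yy1 yy2 (link_rev lp) (link_rev lp') _ _ _ d2 le).
- by move=> z zN1; apply/negP=> /dN; rewrite zN1.
- by move=> i b; have := L2 i b; lia.
- by rewrite size_rev.
- by rewrite size_rev.
Qed.

(** * Subdivided multigraphs *)

Section Subdivided.
Variables (H : sgraph) (x y : H).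
Implicit Types (a b z : H) (s : seq H).

Definition hit a b := [set a; b] == [set x; y].

(** [s] is the interior of a path from [a] to [z]; the result is the interior of its image, with the
    new vertex [None] inserted where the path uses the subdivided edge. *)
Fixpoint subdivided a s z : seq (subdivide x y) :=
  if s is b :: s' then
    (if hit a b then [:: None] else [::]) ++ Some b :: subdivided b s' z
  else if hit a z then [:: None] else [::].

Lemma hitP a b : hit a b -> (a = x /\ b = y) \/ (a = y /\ b = x).
Proof.
move=> /eqP e.
have ha : a \in [set x; y] by rewrite -e !inE eqxx.
have hb : b \in [set x; y] by rewrite -e !inE eqxx orbT.
have hx : x \in [set a; b] by rewrite e !inE eqxx.
have hy : y \in [set a; b] by rewrite e !inE eqxx orbT.
move: ha hb hx hy; rewrite !inE => /orP[]/eqP-> /orP[]/eqP->; auto.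
  by move=> _ /orP[]/eqP->; left.
by move=> /orP[]/eqP->; left.
Qed.

Lemma subdivided_path a s z : path (@adj H) a (rcons s z) ->
  path (@adj (subdivide x y)) (Some a) (rcons (subdivided a s z) (Some z)).
Proof.
have step u v l : adj u v -> path (@adj (subdivide x y)) (Some v) l ->
    path (@adj (subdivide x y)) (Some u)
      ((if hit u v then [:: None] else [::]) ++ Some v :: l).
  move=> uv p; case: ifP => h; last by rewrite /= p uv andbT -[_ == _]/(hit u v) h.
  rewrite /= p andbT; case: (hitP h) => -[-> ->]; by rewrite !inE !eqxx ?orbT.
elim: s a => [|b s IHs] a /=.
  by rewrite andbT => az; have := @step a z [::] az isT; case: ifP.
by case/andP=> ab p; rewrite rcons_cat rcons_cons; apply: step (IHs _ p).
Qed.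

Lemma mem_subdivided_Some a s z c : (Some c \in subdivided a s z) = (c \in s).
Proof.
elim: s a => [|b s IHs] a /=; first by case: ifP.
by rewrite mem_cat !inE IHs; case: ifP => //=; rewrite ?orbF.
Qed.

(** The last conjunct serves disjointness: if two segments both contain [None], an interior vertex
    of one lies on the other, unless both consist of the subdivided edge alone. *)
Lemma mem_subdivided_None a s z : None \in subdivided a s z ->
  (s = [::] /\ hit a z) \/
  [/\ x \in a :: rcons s z, y \in a :: rcons s z & (x \in s) || (y \in s)].
Proof.
elim: s a => [|b s IHs] a /=; first by case: ifP => // h _; left.
rewrite mem_cat inE /= => /orP[h|/IHs h]; right.
  case ab: (hit a b) h => // _; case: (hitP ab) => -[-> ->]; rewrite !inE !eqxx ?orbT //.
case: h => [[-> /hitP h]|[xs ys h]].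
  by case: h => -[-> ->]; rewrite !inE !eqxx ?orbT.
split; first by rewrite inE xs orbT.
  by rewrite inE ys orbT.
by rewrite !inE -orbA; case/orP: h => ->; rewrite ?orbT.
Qed.

Lemma subdivided_uniq a s z : a != z -> uniq s -> a \notin s -> z \notin s ->
  uniq (subdivided a s z).
Proof.
elim: s a => [|b s IHs] a az /=; first by case: ifP.
case/andP=> bs us; rewrite !inE !negb_or => /andP[ab as_] /andP[zb zs].
rewrite cat_uniq /= mem_subdivided_Some bs IHs // 1?eq_sym // andbT.
rewrite andbT; case: ifP => h; last by apply/hasPn.
apply/hasPn=> q qs; rewrite inE; apply: contraL qs => /eqP->.
apply/negP=> /mem_subdivided_None N.
(* A second copy of [None] further on would make the path return to [a]. *)
have : a \in b :: rcons s z.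
  case: N => [[-> /eqP h']|[xs ys _]]; last by case: (hitP h) => -[-> _].
  have : a \in [set b; z] by rewrite h' -(eqP h) !inE eqxx.
  by rewrite !inE.
by rewrite inE mem_rcons inE (negPf ab) (negPf az) (negPf as_).
Qed.

Lemma size_subdivided a s z : size s <= size (subdivided a s z).
Proof.
elim: s a => [|b s IHs] a //=; rewrite size_cat.
by apply: leq_trans (leq_addl _ _); rewrite ltnS.
Qed.

Lemma size_subdivided_hit a s z :
  hit a (head z s) -> size s < size (subdivided a s z).
Proof.
by case: s => [|b s] /= ->; rewrite //= ltnS; apply: size_subdivided.
Qed.

Lemma subdivided_nil a s z : subdivided a s z = [::] -> s = [::].
Proof. by move=> e; have := size_subdivided a s z; rewrite e leqn0 => /nilP. Qed.

End Subdivided.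

(** * Segment models and their behaviour under subdivision *)

Section Model.
Variables (B E : finType) (src tgt : E -> B) (free : rel E).
Hypothesis src_tgt : forall e, src e != tgt e.

(** A copy in [H] of a subdivision of the multigraph with edge set [E]; only [free] pairs of
    segments may meet inside. The last clause keeps two segments without interior vertices from
    being the same edge, as subdividing it would create a common interior vertex. *)
Definition seg_model (H : sgraph) (c : B -> H) (w : E -> seq H) :=
  [/\ injective c,
      forall e, path (@adj H) (c (src e)) (rcons (w e) (c (tgt e))) /\ uniq (w e),
      forall e b, c b \notin w e,
      forall e f z, e != f -> ~~ free e f -> z \in w e -> z \notin w f &
      forall e f, e != f -> ~~ free e f -> w e = [::] -> w f = [::] ->
        [set c (src e); c (tgt e)] != [set c (src f); c (tgt f)]].

Lemma seg_model_subdivide (H : sgraph) (x y : H) c w : seg_model c w ->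
  @seg_model (subdivide x y) (fun b => Some (c b))
    (fun e => subdivided x y (c (src e)) (w e) (c (tgt e))).
Proof.
case=> ci pw cw dw ew; split.
- by move=> a b [/ci].
- move=> e; have [p u] := pw e; split; first exact: subdivided_path.
  by apply: subdivided_uniq; rewrite ?(inj_eq ci).
- by move=> e b; rewrite mem_subdivided_Some.
- move=> e f [z|] ef nf; first by rewrite !mem_subdivided_Some; apply: dw.
  have ends g z : z \in c (src g) :: rcons (w g) (c (tgt g)) -> z \in w g \/ exists b, z = c b.
    rewrite inE mem_rcons inE => /or3P[/eqP->|/eqP->|]; auto; right; eauto.
  have clash g g' z : z \in w g -> z \in c (src g') :: rcons (w g') (c (tgt g')) ->
      (z \in w g -> z \notin w g') -> False.
    move=> zg /ends[zg'|[b zb]] /(_ zg); first by rewrite zg'.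
    by move: zg; rewrite zb (negPf (cw _ _)).
  move=> /mem_subdivided_None h1; apply/negP=> /mem_subdivided_None h2.
  have hh g : hit x y (c (src g)) (c (tgt g)) ->
      x \in c (src g) :: rcons (w g) (c (tgt g)) /\ y \in c (src g) :: rcons (w g) (c (tgt g)).
    by move=> /hitP[] [-> ->]; rewrite !inE !mem_rcons !inE !eqxx !orbT.
  case: h1 h2 => [[e0 /[dup] he /hh[xe ye]]|[xe ye /orP[z|z]]]
                 [[f0 /[dup] hf /hh[xf yf]]|[xf yf zf]].
  + by have := ew e f ef nf e0 f0; rewrite (eqP he) (eqP hf) eqxx.
  + have dw' z : z \in w f -> z \notin w e by apply: contraL; apply: dw.
    by case/orP: zf => zf; [apply: (clash f e _ zf xe) | apply: (clash f e _ zf ye)]; apply: dw'.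
  + by apply: (clash e f _ z xf); apply: dw.
  + by apply: (clash e f _ z xf); apply: dw.
  + by apply: (clash e f _ z yf); apply: dw.
  + by apply: (clash e f _ z yf); apply: dw.
- move=> e f ef nf /subdivided_nil e0 /subdivided_nil f0.
  have := ew e f ef nf e0 f0; apply: contraNneq => h.
  have im g : [set (Some (c (src g)) : subdivide x y); Some (c (tgt g))] = Some @: [set c (src g); c (tgt g)].
    by rewrite imsetU1 imset_set1.
  by move: h; rewrite !im => /imset_inj-> // ? ? [].
Qed.

Lemma seg_model_subdivision (H K : sgraph) c w L : subdivision H K ->
    @seg_model H c w -> (forall e, L <= size (w e)) ->
  exists c' w', @seg_model K c' w' /\ forall e, L <= size (w' e).
Proof.
move=> sub m hL; elim: sub => [|K' x y _ [c' [w' [m' hL']]] _]; first by exists c, w.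
do 2!eexists; split; first exact: seg_model_subdivide m'.
by move=> e; apply: leq_trans (hL' e) _; apply: size_subdivided.
Qed.

(** Subdividing the first edge of a segment shorter than [L] lengthens it and shortens no other, so
    the total deficit [\sum_e (L - size (w e))] decreases. *)
Lemma seg_model_grow (G : sgraph) c w L : @seg_model G c w ->
  exists H c' w', [/\ subdivision G H, @seg_model H c' w' &
    forall e, L <= size (w' e)].
Proof.
suff key n : forall (H : sgraph) (c : B -> H) w, \sum_e (L - size (w e)) < n ->
    subdivision G H -> @seg_model H c w ->
    exists H' c' w', [/\ subdivision G H', @seg_model H' c' w' & forall e, L <= size (w' e)].
  by move=> m; apply: key (ltnSn _) (subdivision_refl G) m.
elim: n => // n IHn H {}c {}w hn sub m.
have [hL|/existsNP[e /negP]] := pselect (forall e, L <= size (w e)).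
  by exists H, c, w.
rewrite -ltnNge => we; have [_ pw _ _ _] := m.
have xy : adj (c (src e)) (head (c (tgt e)) (w e)).
  by have [+ _] := pw e; case: (w e) => [|b s] /= /andP[].
apply: IHn (subdivision_step sub xy) (seg_model_subdivide _ _ m).
rewrite ltnS in hn; apply: leq_trans hn; rewrite (bigD1 e) // [X in _ < X](bigD1 e) //= -addSn.
apply: leq_add.
  have := @size_subdivided_hit _ (c (src e)) (head (c (tgt e)) (w e)) (c (src e)) (w e) (c (tgt e)).
  rewrite /hit eqxx => /(_ isT) h.
  by apply: leq_ltn_trans (leq_sub2l L h) _; rewrite ltn_sub2l.
apply: leq_sum => f _; apply: leq_sub2l; exact: size_subdivided.
Qed.

End Model.

(** * Members of the family F_3 *)

Section Beads.
Variable G : sgraph.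
Implicit Types (x y z : G) (p q : seq G).

Lemma mem_edges q (e : {set G}) :
  e \in edges q <-> exists l a b r, q = l ++ [:: a, b & r] /\ e = [set a; b].
Proof.
rewrite inE; split.
  case/mapP=> -[a b] /= ab ->; elim: q ab => [|c [|d q] IHq] //=.
  rewrite inE => /orP[/eqP[-> ->]|/IHq[l [a' [b' [r [-> e']]]]]].
    by exists [::], c, d, q.
  by exists (c :: l), a', b', r.
case=> l [a [b [r [-> ->]]]]; apply/mapP; exists (a, b) => //.
elim: l => [|c l IHl] /=; first by rewrite mem_head.
by case: l IHl => [|d l] /= IHl; rewrite inE IHl orbT.
Qed.

Lemma edges_rev q : edges (rev q) = edges q.
Proof.
have sub p (e : {set G}) : e \in edges p -> e \in edges (rev p).
  move/mem_edges=> [l [a [b [r [-> ->]]]]]; apply/mem_edges.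
  exists (rev r), b, a, (rev l); split; last exact: setUC.
  by rewrite rev_cat !rev_cons -!cats1 -!catA.
by apply/setP=> e; apply/idP/idP => /sub //; rewrite revK.
Qed.

Lemma verts_rev q : verts (rev q) = verts q.
Proof. by apply/setP=> z; rewrite !inE mem_rev. Qed.

Lemma is_path_rev x y q : is_path x y q -> is_path y x (rev q).
Proof.
case=> q' [-> p u l]; case/lastP: q' p u l => [|q' z] p u l.
  by move: l => /= l; exists [::]; rewrite -l.
rewrite last_rcons in l; subst z; exists (rcons (rev q') x); split.
- by rewrite rev_cons rev_rcons.
- exact: rev_adj_path.
- by rewrite rev_uniq.
- by rewrite last_rcons.
Qed.

Lemma is_bipath_rev x y (B : seq G * seq G) :
  is_bipath x y B -> is_bipath y x (rev B.1, rev B.2).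
Proof.
case=> p1 p2 d s f; split => /=; rewrite ?edges_rev ?verts_rev //.
- exact: is_path_rev.
- exact: is_path_rev.
- rewrite !filter_rev; congr rev.
  have -> : [seq z <- B.1 | z \in rev B.2] = [seq z <- B.1 | z \in B.2].
    by apply: eq_filter => z; rewrite mem_rev.
  by rewrite f; apply: eq_filter => z; rewrite mem_rev.
Qed.

Lemma is_path_rcons x y q : is_path x y q -> x != y ->
  exists2 q', q = x :: rcons q' y & path (@adj G) x (rcons q' y).
Proof.
case=> q' [-> p _ l] xy; case/lastP: q' p l => [|q' z] p l.
  by move: l xy => /= ->; rewrite eqxx.
by rewrite last_rcons in l; subst z; exists q'.
Qed.

(** Cuts [x :: q] in front of each vertex of [q] satisfying [a]; a block is its first vertex
    together with the vertices up to the next cut. The cuts will be the shared vertices of a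
    bipath. *)
Lemma blocks_exist (a : pred G) x q : exists L : seq (G * seq G),
  [/\ x :: q = flatten [seq b.1 :: b.2 | b <- L],
      map fst L = x :: filter a q & all (fun b => all (predC a) b.2) L].
Proof.
elim: q x => [|y q IHq] x; first by exists [:: (x, [::])].
have [L [e f d]] := IHq y; case: L e f d => [|[z u] L] //= [zy e] [_ f] /andP[du d].
subst z; case: (boolP (a y)) => ay.
  exists ((x, [::]) :: (y, u) :: L); split=> /=; first by rewrite e.
    by rewrite ?ay f.
  by rewrite du d.
exists ((x, y :: u) :: L); split=> /=; first by rewrite e.
  by rewrite ?(negPf ay) f.
by rewrite ay du d.
Qed.

(** A shared vertex of a bipath with the interiors of the two sides leading to the next shared
    vertex. *)
Definition bead := (G * (seq G * seq G))%type.
Definition ring1 (L : seq bead) := flatten [seq b.1 :: b.2.1 | b <- L].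
Definition ring2 (L : seq bead) := flatten [seq b.1 :: b.2.2 | b <- L].

Lemma ring1_cat L L' : ring1 (L ++ L') = ring1 L ++ ring1 L'.
Proof. by rewrite /ring1 map_cat flatten_cat. Qed.

Lemma ring2_cat L L' : ring2 (L ++ L') = ring2 L ++ ring2 L'.
Proof. by rewrite /ring2 map_cat flatten_cat. Qed.

Lemma beads_merge (L1 L2 : seq (G * seq G)) : map fst L1 = map fst L2 ->
  exists L : seq bead, [/\ ring1 L = flatten [seq b.1 :: b.2 | b <- L1],
    ring2 L = flatten [seq b.1 :: b.2 | b <- L2], map fst L = map fst L1,
    forall b, b \in L -> (b.1, b.2.1) \in L1 & forall b, b \in L -> (b.1, b.2.2) \in L2].
Proof.
elim: L1 L2 => [|[z u] L1 IHL] [|[z' u'] L2] //=; first by exists [::].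
case=> <- /IHL[L [e1 e2 f h1 h2]]; exists ((z, (u, u')) :: L).
rewrite /ring1 /ring2 /= -/(ring1 L) -/(ring2 L) e1 e2 f; split=> // b.
  by rewrite !in_cons => /orP[/eqP->|/h1->]; rewrite ?orbT //= eqxx.
by rewrite !in_cons => /orP[/eqP->|/h2->]; rewrite ?orbT //= eqxx.
Qed.

(** Beads lie between consecutive shared vertices, and the equal order on both paths matches up the
    blocks. Three shared vertices give two beads; edge-disjointness forbids two empty sides. The
    endpoint [y] begins no bead, so that the beads of a bipath starting at [y] can be appended. *)
Lemma bipath_beads x y B : is_bipath x y B -> exists L : seq bead,
  [/\ [/\ B.1 = rcons (ring1 L) y, B.2 = rcons (ring2 L) y & 1 < size L],
      exists L', map fst L = x :: L',
      forall b, b \in L -> {in b.2.1, forall z, z \notin B.2},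
      forall b, b \in L -> {in b.2.2, forall z, z \notin B.1} &
      forall b, b \in L -> b.2.1 = [::] -> b.2.2 <> [::]].
Proof.
move=> bip; have [p1 p2 disj sh ord] := bip.
have u1 : uniq B.1 by case: p1 => q [->].
have cardS : #|verts B.1 :&: verts B.2| = size [seq z <- B.1 | z \in B.2].
  rewrite -(card_uniqP (filter_uniq _ u1)); apply: eq_card => z.
  by rewrite !inE mem_filter andbC.
have xy : x != y.
  apply/eqP=> xy; case: p1 cardS sh => q [-> _ uq lq] ->; subst y.
  case: q uq lq => [|a q] /= uq lq; first by case: ifP.
  by case/andP: uq; rewrite -{1}lq mem_last.
have [q1 e1 _] := is_path_rcons p1 xy; have [q2 e2 _] := is_path_rcons p2 xy.
have [L1 [f1 g1 d1]] := blocks_exist (mem B.2) x q1.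
have [L2 [f2 g2 d2]] := blocks_exist (mem B.1) x q2.
have in1 : x \in B.1 /\ y \in B.1 by rewrite e1 mem_head inE mem_rcons mem_head orbT.
have in2 : x \in B.2 /\ y \in B.2 by rewrite e2 mem_head inE mem_rcons mem_head orbT.
have ord' : filter (mem B.2) q1 = filter (mem B.1) q2.
  move: ord; rewrite [X in filter _ X = _]e1 [X in _ = filter _ X]e2 /= in1.1 in2.1 !filter_rcons in1.2 in2.2.
  by case=> /rcons_inj[].
have [|L [h1 h2 h3 h4 h5]] := @beads_merge L1 L2; first by rewrite g1 g2 ord'.
have E1 : B.1 = rcons (ring1 L) y by rewrite h1 -f1 e1.
have E2 : B.2 = rcons (ring2 L) y by rewrite h2 -f2 e2.
exists L; split; first split=> //.
- have := congr1 size h3; rewrite g1 !size_map /= => ->.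
  move: sh; rewrite cardS e1 /= in2.1 filter_rcons in2.2 /= size_rcons.
  by rewrite !ltnS.
- by rewrite h3 g1; eexists.
- by move=> b /h4 /(allP d1) /allP bd z /bd.
- by move=> b /h5 /(allP d2) /allP bd z /bd.
- move=> b /splitPr bL b1 b2; case: bL E1 E2 => l r.
  (* An empty side is an edge from [b.1] to the next shared vertex, which is [y] when [b] is the
     last bead. *)
  have key (R : seq bead -> seq G) (s : bead -> seq G) B' :
      (forall l, R l = flatten [seq b.1 :: s b | b <- l]) -> s b = [::] ->
      B' = rcons (R (l ++ b :: r)) y -> [set b.1; head y (map fst r)] \in edges B'.
    move=> RE sb ->; apply/mem_edges; rewrite RE map_cat flatten_cat /= sb /=.
    rewrite rcons_cat rcons_cons; case: r => [|b' r] /=; by do 4!eexists.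
  move=> /(key ring1 (fun b => b.2.1) _ (fun _ => erefl) b1) k1.
  move=> /(key ring2 (fun b => b.2.2) _ (fun _ => erefl) b2) k2.
  by move: disj; rewrite disjoint_subset => /subsetP/(_ _ k1); rewrite inE k2.
Qed.


Section OfBeads.
Variables (b0 : bead) (L : seq bead).
Local Notation bead_at i := (nth b0 L i).

Section Strand.
Variable s : bead -> seq G.
Local Notation F := (fun L' : seq bead => flatten [seq b.1 :: s b | b <- L']).

Lemma strand_path (i : 'I_(size L)) : cycle (@adj G) (F L) ->
  path (@adj G) (bead_at i).1 (rcons (s (bead_at i)) (bead_at (ordS i)).1).
Proof.
have iL := ltn_ord i; set b := bead_at i.
have eL : L = take i L ++ b :: drop i.+1 L by rewrite -drop_nth // cat_take_drop.
(* The cyclic successor; the default [b] is the right value when [L] has a single bead. *)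
have -> : bead_at (ordS i) = head b (drop i.+1 L ++ take i L).
  rewrite /=; case: (ltnP i.+1 (size L)) => [lt|ge].
    by rewrite modn_small // (drop_nth b0).
  have -> : i.+1 %% size L = 0 by rewrite (_ : i.+1 = size L) ?modnn //; lia.
  rewrite drop_oversize //= /b; case: (nat_of_ord i) => [|n]; first by rewrite take0.
  by case: L.
rewrite {1}eL map_cat flatten_cat cycle_catC /= -!catA -flatten_cat -map_cat.
case: (drop i.+1 L ++ take i L) => [|b' r] /=; first by rewrite cats0.
by rewrite rcons_cat rcons_cons -cat_rcons cat_path => /andP[].
Qed.

Lemma strand_disjoint i j z : uniq (F L) -> i != j -> i < size L -> j < size L ->
  z \in (bead_at i).1 :: s (bead_at i) -> z \notin (bead_at j).1 :: s (bead_at j).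
Proof.
move=> uF ij iL jL zi.
wlog lt : i j ij iL jL zi / i < j.
  move=> wl; case: (ltngtP i j) => [lt|lt|e]; last by rewrite e eqxx in ij.
    exact: (wl i j).
  by apply/negP=> zj; have := wl j i; rewrite eq_sym zi => /(_ ij jL iL zj lt).
apply/negP=> zj; move: uF.
rewrite -(cat_take_drop j L) map_cat flatten_cat cat_uniq => /and3P[_ /hasPn dF _].
have zd : z \in F (drop j L).
  by apply/flatten_mapP; exists (bead_at j); rewrite // (drop_nth b0 jL) mem_head.
have /negP[] := dF z zd; apply/flatten_mapP; exists (bead_at i) => //.
by rewrite -(nth_take b0 lt) mem_nth // size_take jL.
Qed.

Lemma strand_uniq i : uniq (F L) -> i < size L ->
  uniq ((bead_at i).1 :: s (bead_at i)).
Proof.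
move=> uF iL; rewrite -(cat_take_drop i L) map_cat flatten_cat cat_uniq in uF.
case/and3P: uF => _ _; rewrite (drop_nth b0 iL) map_cons.
by rewrite -[flatten (_ :: _)]/(_ ++ _) cat_uniq => /and3P[].
Qed.

End Strand.

Definition bead_vertex (i : 'I_(size L)) := (bead_at i).1.
Definition bead_side (i : 'I_(size L)) (t : bool) :=
  if t then (bead_at i).2.1 else (bead_at i).2.2.

Lemma beads_necklace :
    cycle (@adj G) (ring1 L) -> cycle (@adj G) (ring2 L) ->
    uniq (ring1 L) -> uniq (ring2 L) ->
    (forall b, b \in L -> {in b.2.1, forall z, z \notin ring2 L}) ->
    (forall b, b \in L -> {in b.2.2, forall z, z \notin ring1 L}) ->
  necklace bead_vertex bead_side.
Proof.
move=> c1 c2 u1 u2 d1 d2.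
have inL (i : 'I_(size L)) : bead_at i \in L by rewrite mem_nth.
have in1 (i : 'I_(size L)) z : z \in (bead_at i).1 :: (bead_at i).2.1 -> z \in ring1 L.
  by move=> zi; apply/flatten_mapP; exists (bead_at i).
have in2 (i : 'I_(size L)) z : z \in (bead_at i).1 :: (bead_at i).2.2 -> z \in ring2 L.
  by move=> zi; apply/flatten_mapP; exists (bead_at i).
split.
- move=> i j e; apply/eqP; apply: contraT => ij.
  have := strand_disjoint u1 ij (ltn_ord i) (ltn_ord j) (mem_head _ _).
  by rewrite [(bead_at i).1]e mem_head.
- by move=> i []; [exact: (strand_path i c1) | exact: (strand_path i c2)].
- by move=> i []; [have /andP[] := strand_uniq u1 (ltn_ord i) | have /andP[] := strand_uniq u2 (ltn_ord i)].
- move=> i [] j; apply/negP=> h.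
    by have /negP[] := d1 _ (inL i) _ h; apply: (in2 j); exact: mem_head.
  by have /negP[] := d2 _ (inL i) _ h; apply: (in1 j); exact: mem_head.
- move=> i t j t' z ne zi; apply/negP=> zj.
  case: t t' ne zi zj => [] [] ne zi zj.
  + have ij : i != j by apply: contraNneq ne => ->.
    have := strand_disjoint u1 ij (ltn_ord i) (ltn_ord j) (z := z).
    by rewrite !inE zi zj !orbT => /(_ isT).
  + by have /negP[] := d1 _ (inL i) _ zi; apply: (in2 j); rewrite inE [z \in _]zj orbT.
  + by have /negP[] := d2 _ (inL i) _ zi; apply: (in1 j); rewrite inE [z \in _]zj orbT.
  + have ij : i != j by apply: contraNneq ne => ->.
    have := strand_disjoint u2 ij (ltn_ord i) (ltn_ord j) (z := z).
    by rewrite !inE zi zj !orbT => /(_ isT).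
Qed.

End OfBeads.

Lemma two_paths_cycle x y A A' :
    is_path x y (rcons A y) -> is_path y x (rcons A' x) -> x != y ->
    (forall z, z \in rcons A y -> z \in rcons A' x -> z = x \/ z = y) ->
  cycle (@adj G) (A ++ A') /\ uniq (A ++ A').
Proof.
move=> p p' xy dis; have yx : y != x by rewrite eq_sym.
have [q e pq] := is_path_rcons p xy; have [q' e' pq'] := is_path_rcons p' yx.
have u : uniq (rcons A y) by case: p => ? [->].
have u' : uniq (rcons A' x) by case: p' => ? [->].
have eA : A = x :: q by move: e; rewrite -rcons_cons => /rcons_inj[].
have eA' : A' = y :: q' by move: e'; rewrite -rcons_cons => /rcons_inj[].
split.
  by rewrite eA eA' /= -cat_rcons rcons_cat cat_path pq last_rcons.
move: u u'; rewrite !rcons_uniq => /andP[yA uA] /andP[xA' uA'].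
rewrite cat_uniq uA uA' andbT /=; apply/hasPn=> z zA'; apply/negP=> /= zA.
have [||zx|zy] := dis z; rewrite ?mem_rcons ?inE ?zA ?zA' ?orbT //.
  by rewrite -zx zA' in xA'.
by rewrite -zy zA in yA.
Qed.

(** [Ba] is followed from [x] to [y], then [Bb] reversed back to [x]. The joint [x] gets index 0 and
    [y] index [size La]; each bipath has at least two beads, so they are not consecutive. *)
Lemma bipaths_necklace x y Ba Bb :
    is_bipath x y Ba -> is_bipath x y Bb -> bverts Ba :&: bverts Bb = [set x; y] ->
  exists k (c : 'I_k -> G) w i j,
    [/\ 3 < k, necklace c w, forall i, w i true = [::] -> w i false <> [::],
        [/\ c i = x, c j = y, i != j, ordS i != j & ordS j != i] &
        {subset necklace_verts c w <= bverts Ba :|: bverts Bb}].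
Proof.
move=> bipa bipb ab; have bipb' := is_bipath_rev bipb.
have [La [[a1 a2 as_] [Ha fa] da1 da2 ea]] := bipath_beads bipa.
have [Lb [[b1 b2 bs] [Hb fb] db1 db2 eb]] := bipath_beads bipb'.
rewrite /= in b1 b2 db1 db2.
have inter z : z \in bverts Ba -> z \in bverts Bb -> z = x \/ z = y.
  move=> za zb; have : z \in [set x; y] by rewrite -ab inE za.
  by rewrite !inE => /orP[]/eqP; auto.
have [pa1 pa2 _ _ _] := bipa; have [pb1 pb2 _ _ _] := bipb'.
have ends (q : seq G) u v : is_path u v q -> u \in q /\ v \in q.
  by case=> q' [-> _ _ <-]; rewrite mem_head mem_last.
have vb1 z : z \in rev Bb.1 -> z \in bverts Bb by rewrite mem_rev !inE => ->.
have vb2 z : z \in rev Bb.2 -> z \in bverts Bb by rewrite mem_rev !inE => ->; rewrite orbT.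
have va1 z : z \in Ba.1 -> z \in bverts Ba by rewrite !inE => ->.
have va2 z : z \in Ba.2 -> z \in bverts Ba by rewrite !inE => ->; rewrite orbT.
have xy : x != y.
  have : uniq Ba.1 by case: pa1 => ? [->].
  rewrite a1 rcons_uniq => /andP[+ _]; apply: contraNneq => <-.
  by case: (La) fa => [|b l] //= [<- _]; rewrite mem_head.
have [cy1 un1] : cycle (@adj G) (ring1 La ++ ring1 Lb) /\ uniq (ring1 La ++ ring1 Lb).
  apply: (@two_paths_cycle x y); rewrite -?a1 -?b1 //.
  by move=> z /va1 za /vb1; apply: inter.
have [cy2 un2] : cycle (@adj G) (ring2 La ++ ring2 Lb) /\ uniq (ring2 La ++ ring2 Lb).
  apply: (@two_paths_cycle x y); rewrite -?a2 -?b2 //.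
  by move=> z /va2 za /vb2; apply: inter.
have ra1 z : z \in ring1 La -> z \in Ba.1 by rewrite a1 mem_rcons inE => ->; rewrite orbT.
have ra2 z : z \in ring2 La -> z \in Ba.2 by rewrite a2 mem_rcons inE => ->; rewrite orbT.
have rb1 z : z \in ring1 Lb -> z \in rev Bb.1 by rewrite b1 mem_rcons inE => ->; rewrite orbT.
have rb2 z : z \in ring2 Lb -> z \in rev Bb.2 by rewrite b2 mem_rcons inE => ->; rewrite orbT.
have s1 (l : seq bead) b z : b \in l -> z \in b.2.1 -> z \in ring1 l.
  by move=> bl zb; apply/flatten_mapP; exists b => //; rewrite inE zb orbT.
have s2 (l : seq bead) b z : b \in l -> z \in b.2.2 -> z \in ring2 l.
  by move=> bl zb; apply/flatten_mapP; exists b => //; rewrite inE zb orbT.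
have [xa1 ya1] := ends _ _ _ pa1; have [xa2 ya2] := ends _ _ _ pa2.
have [yb1 xb1] := ends _ _ _ pb1; have [yb2 xb2] := ends _ _ _ pb2.
have N : necklace (@bead_vertex (x, ([::], [::])) (La ++ Lb))
    (@bead_side (x, ([::], [::])) (La ++ Lb)).
  apply: beads_necklace; rewrite ?ring1_cat ?ring2_cat // => b; rewrite mem_cat => /orP[bL|bL] z zb;
    rewrite mem_cat negb_or.
  - have zn := da1 b bL z zb; rewrite (contra (@ra2 z)) //=.
    apply/negP=> /rb2/vb2 h; case: (inter z) => [||zx|zy] //; last by rewrite zy ya2 in zn.
      exact: va1 (ra1 _ (s1 _ _ _ bL zb)).
    by rewrite zx xa2 in zn.
  - have zn := db1 b bL z zb; rewrite (contra (@rb2 z)) ?andbT //=.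
    apply/negP=> /ra2/va2 h; case: (inter z) => [||zx|zy] //; last by rewrite zy yb2 in zn.
      exact: vb1 (rb1 _ (s1 _ _ _ bL zb)).
    by rewrite zx xb2 in zn.
  - have zn := da2 b bL z zb; rewrite (contra (@ra1 z)) //=.
    apply/negP=> /rb1/vb1 h; case: (inter z) => [||zx|zy] //; last by rewrite zy ya1 in zn.
      exact: va2 (ra2 _ (s2 _ _ _ bL zb)).
    by rewrite zx xa1 in zn.
  - have zn := db2 b bL z zb; rewrite (contra (@rb1 z)) ?andbT //=.
    apply/negP=> /ra1/va1 h; case: (inter z) => [||zx|zy] //; last by rewrite zy yb1 in zn.
      exact: vb2 (rb2 _ (s2 _ _ _ bL zb)).
    by rewrite zx xb1 in zn.
have sz : size (La ++ Lb) = size La + size Lb by rewrite size_cat.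
have i_lt : 0 < size (La ++ Lb) by rewrite sz ltn_addr // ltnW.
have j_lt : (size La).+1 < size (La ++ Lb) by rewrite sz -addn1 ltn_add2l.
exists (size (La ++ Lb)), (@bead_vertex (x, ([::], [::])) (La ++ Lb)),
  (@bead_side (x, ([::], [::])) (La ++ Lb)), (Ordinal i_lt), (Ordinal (ltnW j_lt)); split; last first.
- move=> z; rewrite mem_necklace_verts.
  have at_ (i : 'I_(size (La ++ Lb))) : nth (x, ([::], [::])) (La ++ Lb) i \in La ++ Lb by rewrite mem_nth.
  have r1 (l : seq bead) b : b \in l -> b.1 \in ring1 l.
    by move=> bl; apply/flatten_mapP; exists b => //; exact: mem_head.
  have r1V u : u \in ring1 (La ++ Lb) -> u \in bverts Ba :|: bverts Bb.
    rewrite ring1_cat mem_cat inE => /orP[/ra1/va1->//|/rb1/vb1->]; exact: orbT.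
  have r2V u : u \in ring2 (La ++ Lb) -> u \in bverts Ba :|: bverts Bb.
    rewrite ring2_cat mem_cat inE => /orP[/ra2/va2->//|/rb2/vb2->]; exact: orbT.
  case/orP=> [/existsP[i /eqP->]|/existsP[[i []] zi]].
  + exact: r1V (r1 _ _ (at_ i)).
  + exact: r1V (s1 _ _ _ (at_ i) zi).
  + exact: r2V (s2 _ _ _ (at_ i) zi).
- split; rewrite /bead_vertex /= ?nth_cat ?ltnn ?subnn.
  + by case: (La) fa as_ => [|b l] //= [<- _].
  + by case: (Lb) fb => [|b l] //= [<- _].
  + by apply/eqP=> /(congr1 val) /= e; rewrite -e in as_.
  + apply/eqP=> /(congr1 val) /=; rewrite modn_small => [e|]; first by rewrite -e in as_.
    exact: leq_ltn_trans (ltnW as_) (ltnW j_lt).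
  + by apply/eqP=> /(congr1 val) /=; rewrite modn_small.
- move=> i; have : nth (x, ([::], [::])) (La ++ Lb) i \in La ++ Lb by rewrite mem_nth.
  by rewrite mem_cat => /orP[h|h]; [exact: (ea _ h) | exact: (eb _ h)].
- exact: N.
- by rewrite sz; apply: (leq_add as_ bs).
Qed.

End Beads.

Lemma ordS2_neq k (i : 'I_k) : 2 < k -> ordS (ordS i) != i.
Proof.
move=> kgt; apply/eqP=> /(congr1 val); rewrite -[ordS (ordS i)]/(iter 2 (@ordS k) i).
rewrite /= -[LHS]/(nat_of_ord (iter 2 (@ordS k) i)) iter_ordS => e.
have ik := ltn_ord i.
have : i + 2 = i %[mod k] by rewrite e modn_small.
move/eqP; rewrite -[X in _ == X %[mod _]]addn0 eqn_modDl mod0n modn_small //.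
Qed.

Lemma necklace_edge_neq k (G : sgraph) (c : 'I_k -> G) i j : injective c -> 2 < k ->
  i != j -> [set c i; c (ordS i)] != [set c j; c (ordS j)].
Proof.
move=> ci kgt ij; apply: contraNneq ij => e.
have : c i \in [set c j; c (ordS j)] by rewrite -e !inE eqxx.
have : c j \in [set c i; c (ordS i)] by rewrite e !inE eqxx.
rewrite !inE !(inj_eq ci) => /orP[/eqP->//|/eqP ji] /orP[//|/eqP ij].
by have := ordS2_neq i kgt; rewrite -ji -ij eqxx.
Qed.

(** * Two linked necklaces as one segment model *)

Section Assembly.
Variables (k1 k2 : nat) (i1 j1 : 'I_k1) (i2 j2 : 'I_k2).
Hypotheses (k1_gt1 : 1 < k1) (k2_gt1 : 1 < k2).

Definition joint := ('I_k1 + 'I_k2)%type.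
Definition strand := ('I_k1 * bool + 'I_k2 * bool + bool)%type.

Definition strand_src (e : strand) : joint :=
  match e with
  | inl (inl (i, _)) => inl i
  | inl (inr (i, _)) => inr i
  | inr t => inl (if t then j1 else i1)
  end.

Definition strand_tgt (e : strand) : joint :=
  match e with
  | inl (inl (i, _)) => inl (ordS i)
  | inl (inr (i, _)) => inr (ordS i)
  | inr t => inr (if t then j2 else i2)
  end.

(* The two linking paths are allowed to meet each other. *)
Definition strand_free (e f : strand) : bool :=
  match e, f with inr _, inr _ => true | _, _ => false end.

Lemma strand_src_tgt e : strand_src e != strand_tgt e.
Proof. by case: e => [[[i b]|[i b]]|b] //=; rewrite eq_sym; exact: ordS_neq. Qed.

Definition joint_map (G : sgraph) (c1 : 'I_k1 -> G) (c2 : 'I_k2 -> G) (b : joint) :=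
  match b with inl i => c1 i | inr i => c2 i end.

Definition strand_map (G : sgraph) (w1 : 'I_k1 -> bool -> seq G)
    (w2 : 'I_k2 -> bool -> seq G) (p p' : seq G) (e : strand) :=
  match e with
  | inl (inl (i, b)) => w1 i b
  | inl (inr (i, b)) => w2 i b
  | inr t => if t then p' else p
  end.

(** The delicate clause concerns two segments that are single edges: on one bead the hypothesis on
    empty sides excludes it, and edges of different beads differ because a necklace has more than
    two joints. *)
Lemma seg_model_of_necklaces (G : sgraph) (c1 : 'I_k1 -> G) w1 (c2 : 'I_k2 -> G) w2 p p' :
    2 < k1 -> 2 < k2 -> necklace c1 w1 -> necklace c2 w2 ->
    (forall i, w1 i true = [::] -> w1 i false <> [::]) ->
    (forall i, w2 i true = [::] -> w2 i false <> [::]) ->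
    {in necklace_verts c2 w2, forall z, z \notin necklace_verts c1 w1} ->
    link c1 w1 c2 w2 i1 i2 p -> link c1 w1 c2 w2 j1 j2 p' ->
  seg_model strand_src strand_tgt strand_free (joint_map c1 c2) (strand_map w1 w2 p p').
Proof.
move=> k1_gt2 k2_gt2 N1 N2 ne1 ne2 dN [lp up dp1 dp2] [lp' up' dp1' dp2'].
have [ci1 pw1 uw1 cw1 dw1] := N1; have [ci2 pw2 uw2 cw2 dw2] := N2.
have v1 i : c1 i \in necklace_verts c1 w1.
  by rewrite mem_necklace_verts; apply/orP; left; apply/existsP; exists i.
have v2 i : c2 i \in necklace_verts c2 w2.
  by rewrite mem_necklace_verts; apply/orP; left; apply/existsP; exists i.
have s1 i b z : z \in w1 i b -> z \in necklace_verts c1 w1.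
  by move=> zw; rewrite mem_necklace_verts; apply/orP; right; apply/existsP; exists (i, b).
have s2 i b z : z \in w2 i b -> z \in necklace_verts c2 w2.
  by move=> zw; rewrite mem_necklace_verts; apply/orP; right; apply/existsP; exists (i, b).
have dN' z : z \in necklace_verts c1 w1 -> z \notin necklace_verts c2 w2.
  by move=> z1; apply/negP=> /dN; rewrite z1.
have c12 i j : c1 i <> c2 j by move=> e; have := dN' _ (v1 i); rewrite e v2.
split.
- move=> [i|i] [j|j] //= e; first by rewrite (ci1 _ _ e).
  + by case: (c12 _ _ e).
  + by case: (c12 _ _ (esym e)).
  + by rewrite (ci2 _ _ e).
- by move=> [[[i b]|[i b]]|[]] /=; split.
- move=> [[[i b]|[i b]]|[]] [j|j] //=; apply/negP=> h.
  + by have := dN _ (v2 j); rewrite (s1 _ _ _ h).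
  + by have := dN _ (s2 _ _ _ h); rewrite v1.
  + by have := dp1' _ h; rewrite v1.
  + by have := dp2' _ h; rewrite v2.
  + by have := dp1 _ h; rewrite v1.
  + by have := dp2 _ h; rewrite v2.
- move=> [[[i b]|[i b]]|t] [[[j b']|[j b']]|t'] z ef //= _ ze; apply/negP=> zf.
  + by have := dw1 i b j b' z ef ze; rewrite zf.
  + by have := dN' _ (s1 _ _ _ ze); rewrite (s2 _ _ _ zf).
  + by case: t' ef zf => _ zf; [have := dp1' _ zf | have := dp1 _ zf]; rewrite (s1 _ _ _ ze).
  + by have := dN _ (s2 _ _ _ ze); rewrite (s1 _ _ _ zf).
  + by have := dw2 i b j b' z ef ze; rewrite zf.
  + by case: t' ef zf => _ zf; [have := dp2' _ zf | have := dp2 _ zf]; rewrite (s2 _ _ _ ze).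
  + by case: t ef ze => _ ze; [have := dp1' _ ze | have := dp1 _ ze]; rewrite (s1 _ _ _ zf).
  + by case: t ef ze => _ ze; [have := dp2' _ ze | have := dp2 _ ze]; rewrite (s2 _ _ _ zf).
- have out (a b d e : G) : a \notin [set d; e] -> [set a; b] != [set d; e].
    by apply: contraNneq => <-; rewrite !inE eqxx.
  have out' (a b d e : G) : d \notin [set a; b] -> [set a; b] != [set d; e].
    by move=> h; rewrite eq_sym; apply: out.
  have n12 i j j' : c1 i \notin [set c2 j; c2 j'].
    by rewrite !inE; apply/norP; split; apply/eqP/c12.
  have n21 i j j' : c2 i \notin [set c1 j; c1 j'].
    by rewrite !inE; apply/norP; split; apply/eqP=> /esym; apply: c12.
  move=> [[[i b]|[i b]]|t] [[[j b']|[j b']]|t'] ef //= _ e0 f0.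
  + have [ij|ij] := eqVneq i j; last exact: necklace_edge_neq.
    move: ef e0 f0; rewrite -ij; case: b b' => [] []; rewrite ?eqxx // => _ h h'.
      by case: (ne1 i h h').
    by case: (ne1 i h' h).
  + exact: out.
  + by rewrite [X in _ != X]setUC; apply: out'.
  + exact: out.
  + have [ij|ij] := eqVneq i j; last exact: necklace_edge_neq.
    move: ef e0 f0; rewrite -ij; case: b b' => [] []; rewrite ?eqxx // => _ h h'.
      by case: (ne2 i h h').
    by case: (ne2 i h' h).
  + exact: out'.
  + by rewrite [X in X != _]setUC; apply: out.
  + exact: out.
Qed.

Lemma necklaces_of_seg_model (G : sgraph) (c : joint -> G) (w : strand -> seq G) :
    seg_model strand_src strand_tgt strand_free c w ->
  let c1 i := c (inl i) in let w1 i b := w (inl (inl (i, b))) in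
  let c2 i := c (inr i) in let w2 i b := w (inl (inr (i, b))) in
  [/\ necklace c1 w1, necklace c2 w2,
      {in necklace_verts c2 w2, forall z, z \notin necklace_verts c1 w1},
      link c1 w1 c2 w2 i1 i2 (w (inr false)) & link c1 w1 c2 w2 j1 j2 (w (inr true))].
Proof.
case=> ci pw cw dw _ c1 w1 c2 w2.
have lk t : link c1 w1 c2 w2 (if t then j1 else i1) (if t then j2 else i2) (w (inr t)).
  have [p u] := pw (inr t); split=> // z zp; rewrite mem_necklace_verts.
  - apply/norP; split; apply/existsPn.
      by move=> j; apply: contraL zp => /eqP->; exact: cw.
    by move=> [j b] /=; apply: dw zp.
  - apply/norP; split; apply/existsPn.
      by move=> j; apply: contraL zp => /eqP->; exact: cw.
    by move=> [j b] /=; apply: dw zp.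
split; [| | | exact: (lk false) | exact: (lk true)].
- split; [by move=> i j /ci[] | by move=> i b; case: (pw (inl (inl (i, b)))) |
    by move=> i b; case: (pw (inl (inl (i, b)))) | by move=> *; exact: cw |].
  by move=> i b i' b' z ne; apply: dw.
- split; [by move=> i j /ci[] | by move=> i b; case: (pw (inl (inr (i, b)))) |
    by move=> i b; case: (pw (inl (inr (i, b)))) | by move=> *; exact: cw |].
  by move=> i b i' b' z ne; apply: dw.
- move=> z; rewrite mem_necklace_verts => /orP[/existsP[i /eqP->]|/existsP[[i b] /= zi]];
    rewrite mem_necklace_verts; apply/norP; split; apply/existsPn.
  + by move=> j; apply/eqP=> /ci.
  + by move=> [j b] /=; exact: cw.
  + by move=> j; apply: contraL zi => /eqP->; exact: cw.
  + by move=> [j b'] /=; apply: dw zi.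
Qed.

End Assembly.

Lemma is_path_link (G : sgraph) (x y : G) P (U : {set G}) :
    is_path x y P -> x != y -> verts P :&: U = [set x; y] ->
  exists p, [/\ path (@adj G) x (rcons p y), uniq p & {in p, forall z, z \notin U}].
Proof.
move=> pP xy PU; have [p e pp] := is_path_rcons pP xy.
have uP : uniq P by case: pP => ? [->].
move: uP; rewrite e /= rcons_uniq mem_rcons inE negb_or => /andP[/andP[_ xp] /andP[yp up]].
exists p; split=> // z zp; apply/negP=> zU.
have : z \in [set x; y] by rewrite -PU !inE zU e inE mem_rcons inE zp !orbT.
by rewrite !inE => /orP[]/eqP zz; [move: xp | move: yp]; rewrite -zz zp.
Qed.

Theorem theorem7p5 (G0 : sgraph) (hG0 : F3 G0) : 4 <= top_inspection_number G0.
Proof.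
have [v1 [v2 [v3 [v4 [Ba [Bb [Bc [Bd [P1 [P2 /= hF]]]]]]]]]] := hG0.
case: hF => -[ba bb bc bd] [ab cd disj] [p1 p2 P1U P2U] _ _.
have [k1 [c1 [w1 [i1 [j1 [k1_gt N1 ne1 [ci1 cj1 ij1 ij1' ij1''] V1]]]]]] := bipaths_necklace ba bb ab.
have [k2 [c2 [w2 [i2 [j2 [k2_gt N2 ne2 [ci2 cj2 ij2 ij2' ij2''] V2]]]]]] := bipaths_necklace bc bd cd.
have dN : {in necklace_verts c2 w2, forall z, z \notin necklace_verts c1 w1}.
  move=> z /V2 z2; apply/negP=> /V1 z1.
  by move: disj; rewrite disjoint_subset => /subsetP/(_ z z1); rewrite inE z2.
have mem1 i : c1 i \in necklace_verts c1 w1.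
  by rewrite mem_necklace_verts; apply/orP; left; apply/existsP; exists i.
have mem2 i : c2 i \in necklace_verts c2 w2.
  by rewrite mem_necklace_verts; apply/orP; left; apply/existsP; exists i.
have neq i j : c1 i != c2 j by apply: contraTneq (dN _ (mem2 j)) => <-; rewrite mem1.
set U := _ :|: bverts Bd in P1U P2U.
have U1 z : z \in necklace_verts c1 w1 -> z \in U.
  by move/V1; rewrite /U !in_setU => ->.
have U2 z : z \in necklace_verts c2 w2 -> z \in U.
  by move/V2; rewrite /U !in_setU => /orP[]->; rewrite !orbT.
have mk (i : 'I_k1) (j : 'I_k2) P : is_path (c1 i) (c2 j) P ->
    verts P :&: U = [set c1 i; c2 j] -> exists p, link c1 w1 c2 w2 i j p.
  move=> /is_path_link/(_ (neq i j)) h /h[p [pp up dp]]; exists p; split=> // z /dp zU.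
    by apply: contra zU => /U1.
  by apply: contra zU => /U2.
have [q lq] : exists p, link c1 w1 c2 w2 i1 i2 p by apply: (mk _ _ P1); rewrite ci1 ci2.
have [q' lq'] : exists p, link c1 w1 c2 w2 j1 j2 p by apply: (mk _ _ P2); rewrite cj1 cj2.
have k1_gt1 : 1 < k1 by lia.
have k2_gt1 : 1 < k2 by lia.
have M := seg_model_of_necklaces (ltnW k1_gt) (ltnW k2_gt) N1 N2 ne1 ne2 dN lq lq'.
(* [L] covers the side lengths required in both necklaces and the 20 required of the links. *)
pose L := 3 * 2 ^ (3 * k1) + k1 + 100 + (3 * 2 ^ (3 * k2) + k2).
(* [H] is the subdivision that defeats three inspections: every further subdivision keeps the
   segment model with all segments of length at least [L]. *)
have [H [c [w [G0H MH wL]]]] := seg_model_grow (strand_src_tgt i1 j1 i2 j2 k1_gt1 k2_gt1) L M.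
rewrite /top_inspection_number; case: ex_minnP => m /asboolP top_m _.
have [H' HH' le_m] := top_m H G0H; apply: leq_trans le_m.
have [c' [w' [M' wL']]] :=
  seg_model_subdivision (strand_src_tgt i1 j1 i2 j2 k1_gt1 k2_gt1) HH' MH wL.
have [N1' N2' dN' l1 l2] := necklaces_of_seg_model M'.
apply: (linked_necklaces_bound k1_gt1 k2_gt1 N1' N2' dN' ij1 ij1' ij1'' ij2 ij2' ij2'' l1 l2).
- by move=> i b; apply: leq_trans (wL' _); rewrite /L leq_addr.
- by move=> i b; apply: leq_trans (wL' _); rewrite /L; lia.
- by apply: leq_trans (wL' _); rewrite /L; lia.
- by apply: leq_trans (wL' _); rewrite /L; lia.
Qed.
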